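(* Let $(M,\omega)$ be a symplectic manifold on which an $n$-dimensional connected Lie group $G$ with Lie algebra $\mathfrak{g}$ acts by a symplectic-Hamiltonian action $\sigma$. Assume that $X,Y\in\mathfrak{g}$ satisfy $[X,Y]=0$. Then the twist $t=\frac12 X\wedge Y\in\Lambda^2\mathfrak{g}$ deforms the symplectic structure $\omega$ to a symplectic structure $\omega_t$; that is, $\pi_M^t:=\pi-t_M$, where $\pi$ is the Poisson structure induced by $\omega$, is a nondegenerate Poisson structure on $M$, and $\omega_t$ is the symplectic structure induced by $\pi_M^t$. For example, a twist $t$ in $\Lambda^2\mathfrak{h}$, where $\mathfrak{h}$ is a Cartan subalgebra of $\mathfrak{g}$, satisfies the assumption of the theorem.
   Context: Symplectic-Hamiltonian action: a smooth left action $\sigma$ of $G$ on $(M,\omega)$ by symplectomorphisms admitting a moment map $\mu:M\to\mathfrak{g}^*$ satisfying (a) $d\mu^X=\iota_{X_M}\omega$ for all $X\in\mathfrak{g}$, where $\mu^X(p)=\langle\mu(p),X\rangle$ and $X_{M,p}=\frac{d}{ds}\big|_{s=0}\sigma_{\exp sX}(p)$, and (b) $\mu\circ\sigma_g=\mathrm{Ad}^*_g\circ\mu$ for all $g\in G$, where $\mathrm{Ad}^*$ is the coadjoint action. For a $2$-vector field $\pi$, $\pi^\sharp:T^*M\to TM$ is defined by $\langle\pi^\sharp(\alpha),\beta\rangle=\pi(\alpha,\beta)$; $\pi$ is nondegenerate if $\pi^\sharp_p$ is an isomorphism for every $p$, and $\pi$ is a Poisson structure if $[\pi,\pi]=0$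 (Schouten bracket). A symplectic form $\omega$ and a nondegenerate Poisson structure $\pi$ induce each other via $\pi^\sharp(\iota_v\omega)=v$ for all tangent vectors $v$. Elements $t\in\Lambda^2\mathfrak{g}$ are called twists; $t_M$ denotes the fundamental $2$-vector field on $M$, determined linearly by $(X\wedge Y)_M=X_M\wedge Y_M$. A twist $t$ is said to deform $\omega$ to a symplectic structure if $\pi-t_M$ is a nondegenerate Poisson structure, the deformed symplectic structure being the one it induces.
   Formalization: ''Cartan subalgebra'' is taken as a maximal abelian subalgebra with ad H semisimple (a nilpotent self-normalizing one need not be abelian); as t in Λ²h need not be of the form ½X∧Y, the example states that elements of h commute and every t in Λ²h deforms ω. *)

(* Defs.v *)
From HB Require Import structures.
From mathcomp Require Import all_boot all_order all_algebra.
From mathcomp Require Import all_classical all_reals all_analysis.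
Set Implicit Arguments.
Unset Strict Implicit.
Unset Printing Implicit Defensive.
Import Order.TTheory GRing.Theory Num.Theory.
Import numFieldNormedType.Exports.
Local Open Scope classical_set_scope.
Local Open Scope ring_scope.

(* Only meant for open U in a finite-dimensional V, where it is the usual
   notion (all iterated partial derivatives exist and are continuous). *)
Fixpoint Ck (R : realType) (V W : normedModType R) (k : nat)
    (U : set V) (f : V -> W) : Prop :=
  (forall x, U x -> {for x, continuous f}) /\
  match k with
  | 0 => True
  | k'.+1 => forall v : V,
      (forall x, U x -> derivable f x v) /\ Ck k' U (fun x => 'D_v f x)
  end.

Definition smooth_on (R : realType) (V W : normedModType R)
    (U : set V) (f : V -> W) : Prop := forall k, Ck k U f.

(* [crd] and [pt] are total; only their values on [dom], resp. on the open set
   [crd @` dom], are meaningful. *)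
Record chart (R : realType) (m : nat) (T : topologicalType) := Chart {
  dom : set T;
  crd : T -> 'rV[R]_m;
  pt : 'rV[R]_m -> T;
  dom_open : open dom;
  img_open : open (crd @` dom);
  crdK : forall x, dom x -> pt (crd x) = x;
  crd_continuous : forall x, dom x -> {for x, continuous crd};
  pt_continuous : forall u, (crd @` dom) u -> {for u, continuous pt} }.

Record manifold (R : realType) (m : nat) := Manifold {
  points :> topologicalType;
  atlas : set (chart R m points);
  points_hausdorff : hausdorff_space points;
  points_second_countable : @second_countable points;
  atlas_cover : forall p : points, exists c, atlas c /\ dom c p;
  atlas_compat : forall c d, atlas c -> atlas d ->
    smooth_on (crd c @` (dom c `&` dom d)) (crd d \o pt c) }.

Arguments atlas {R m} _ _.

(* A chart around p, chosen once and for all. It identifies T_p M with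
   'rV[R]_m and T_p^* M with 'cV[R]_m; every (co)tangent vector, form or
   multivector at p below is written in this identification. In particular
   vector fields are functions M -> 'rV[R]_m, and 2-forms and 2-vector fields
   are functions M -> 'M[R]_m, with omega_p(u, v) = u omega_p v^T and
   pi_p(a, b) = a^T pi_p b. *)
Definition chart_at (R : realType) (m : nat) (M : manifold R m) (p : M) :
  chart R m M := projT1 (cid (atlas_cover p)).

Section Manifolds.
Variable R : realType.

Section OneManifold.
Variables (m : nat) (M : manifold R m).

Definition smooth_function (W : normedModType R) (f : M -> W) : Prop :=
  forall c, atlas M c -> smooth_on (crd c @` dom c) (f \o pt c).

Definition smooth_curve (gamma : R -> M) : Prop :=
  continuous (gamma : R^o -> M) /\
  forall c, atlas M c ->
    smooth_on ((gamma @^-1` dom c) : set R^o) (crd c \o gamma).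

Definition velocity (gamma : R -> M) (s : R) : 'rV[R]_m :=
  derive1 (crd (chart_at (gamma s)) \o gamma) s.

Definition pairing (k : nat) (v : 'rV[R]_k) (a : 'cV[R]_k) : R :=
  (v *m a) 0 0.

Definition differential (f : M -> R) (p : M) : 'cV[R]_m :=
  \col_i 'D_(delta_mx 0 i : 'rV[R]_m) ((f : M -> R^o) \o pt (chart_at p))
    (crd (chart_at p) p).

(* v *m chart_change c d p are the coordinates in d of the tangent vector at p
   with coordinates v in c. *)
Definition chart_change (c d : chart R m M) (p : M) : 'M[R]_m :=
  lin1_mx (fun v : 'rV[R]_m => 'D_v (crd d \o pt c) (crd c p)).

(* The derivation U o V - V o U, evaluated on the coordinate functions of
   chart_at p to get a vector of T_p M. *)
Definition vfield_bracket (U V : M -> 'rV[R]_m) (p : M) : 'rV[R]_m :=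
  let x i : M -> R := fun q => crd (chart_at p) q 0 i in
  let lie (Z : M -> 'rV[R]_m) (f : M -> R) : M -> R :=
    fun q => pairing (Z q) (differential f q) in
  \row_i (lie U (lie V (x i)) p - lie V (lie U (x i)) p).

Definition contraction (v : 'rV[R]_m) (w : 'M[R]_m) : 'cV[R]_m := (v *m w)^T.

Definition form_in_chart (omega : M -> 'M[R]_m) (c : chart R m M)
    (u : 'rV[R]_m) : 'M[R]_m :=
  let p := pt c u in
  let J := chart_change c (chart_at p) p in
  J *m omega p *m J^T.

Definition differential_2form (omega : M -> 'M[R]_m) : Prop :=
  (forall p, (omega p)^T = - omega p) /\
  (forall c, atlas M c ->
     smooth_on (crd c @` dom c) (form_in_chart omega c)).

(* The (i, j, k) coefficient of d omega at p. *)
Definition exterior_derivative (omega : M -> 'M[R]_m) (p : M)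
    (i j k : 'I_m) : R :=
  let c := chart_at p in
  let D (a b d : 'I_m) : R :=
    'D_(delta_mx 0 a : 'rV[R]_m)
      ((fun u => form_in_chart omega c u b d) : 'rV[R]_m -> R^o) (crd c p) in
  D i j k - D j i k + D k i j.

Definition symplectic_form (omega : M -> 'M[R]_m) : Prop :=
  [/\ differential_2form omega,
      forall p i j k, exterior_derivative omega p i j k = 0 &
      forall p v, contraction v (omega p) = 0 -> v = 0].

(* (u /\ v)(a, b) = a(u) b(v) - a(v) b(u) *)
Definition wedge (k : nat) (u v : 'rV[R]_k) : 'M[R]_k :=
  u^T *m v - v^T *m u.

(* The vector such that b (sharp P a) = a^T P b for all b. *)
Definition sharp (P : 'M[R]_m) (a : 'cV[R]_m) : 'rV[R]_m := a^T *m P.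

Definition bivector_in_chart (pi : M -> 'M[R]_m) (c : chart R m M)
    (u : 'rV[R]_m) : 'M[R]_m :=
  let p := pt c u in
  let J := chart_change (chart_at p) c p in
  J^T *m pi p *m J.

Definition bivector_field (pi : M -> 'M[R]_m) : Prop :=
  (forall p, (pi p)^T = - pi p) /\
  (forall c, atlas M c ->
     smooth_on (crd c @` dom c) (bivector_in_chart pi c)).

Definition biderivation (pi : M -> 'M[R]_m) (f g : M -> R) : M -> R :=
  fun p => ((differential f p)^T *m pi p *m differential g p) 0 0.

(* The Schouten bracket of multiderivations, in degree (2, 2): the sum over
   (2, 1)-shuffles of P(Q(f, g), h) + Q(P(f, g), h). *)
Definition schouten_on (P Q : M -> 'M[R]_m) (f g h : M -> R) : M -> R :=
  let T (f1 f2 f3 : M -> R) : M -> R := fun p =>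
    biderivation P (biderivation Q f1 f2) f3 p +
    biderivation Q (biderivation P f1 f2) f3 p in
  fun p => T f g h p + T g h f p + T h f g p.

(* The (i, j, k) coefficient of the 3-vector field [P, Q] at p. *)
Definition schouten (P Q : M -> 'M[R]_m) (p : M) (i j k : 'I_m) : R :=
  let x l : M -> R := fun q => crd (chart_at p) q 0 l in
  schouten_on P Q (x i) (x j) (x k) p.

Definition poisson_structure (pi : M -> 'M[R]_m) : Prop :=
  bivector_field pi /\ forall p i j k, schouten pi pi p i j k = 0.

Definition nondegenerate (pi : M -> 'M[R]_m) : Prop :=
  forall p, bijective (sharp (pi p)).

Definition induces (omega pi : M -> 'M[R]_m) : Prop :=
  forall p v, sharp (pi p) (contraction v (omega p)) = v.

End OneManifold.

Definition smooth_map (m n : nat) (M : manifold R m) (N : manifold R n)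
    (F : M -> N) : Prop :=
  continuous F /\
  forall c d, atlas M c -> atlas N d ->
    smooth_on (crd c @` (dom c `&` F @^-1` dom d)) (crd d \o F \o pt c).

(* Joint smoothness, i.e. smoothness on the product manifold M x N. *)
Definition smooth_map2 (m n k : nat) (M : manifold R m) (N : manifold R n)
    (P : manifold R k) (F : M -> N -> P) : Prop :=
  continuous (fun x : M * N => F x.1 x.2) /\
  forall c d e, atlas M c -> atlas N d -> atlas P e ->
    smooth_on
      [set u : 'rV[R]_m * 'rV[R]_n |
        [/\ (crd c @` dom c) u.1, (crd d @` dom d) u.2 &
            dom e (F (pt c u.1) (pt d u.2))]]
      (fun u => crd e (F (pt c u.1) (pt d u.2))).

(* T_p M -> T_(F p) N *)
Definition tangent_map (m n : nat) (M : manifold R m) (N : manifold R n)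
    (F : M -> N) (p : M) (v : 'rV[R]_m) : 'rV[R]_n :=
  'D_v (crd (chart_at (F p)) \o F \o pt (chart_at p)) (crd (chart_at p) p).

Record lie_group (n : nat) := LieGroup {
  lg_manifold :> manifold R n;
  lg_mul : lg_manifold -> lg_manifold -> lg_manifold;
  lg_one : lg_manifold;
  lg_inv : lg_manifold -> lg_manifold;
  lg_mulA : associative lg_mul;
  lg_mul1g : left_id lg_one lg_mul;
  lg_mulg1 : right_id lg_one lg_mul;
  lg_mulVg : left_inverse lg_one lg_inv lg_mul;
  lg_mulgV : right_inverse lg_one lg_inv lg_mul;
  lg_mul_smooth : smooth_map2 lg_mul;
  lg_inv_smooth : smooth_map lg_inv }.

(* The Lie algebra of G is T_1 G = 'rV[R]_n, with dual 'cV[R]_n. *)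
Section LieGroups.
Variables (n : nat) (G : lie_group n).

Definition left_invariant (X : 'rV[R]_n) (g : G) : 'rV[R]_n :=
  tangent_map (lg_mul g) (lg_one G) X.

Definition lie_bracket (X Y : 'rV[R]_n) : 'rV[R]_n :=
  vfield_bracket (left_invariant X) (left_invariant Y) (lg_one G).

(* This characterizes exp: s |-> exp(sX) is the one-parameter subgroup with
   initial velocity X. *)
Definition exponential_map (expG : 'rV[R]_n -> G) : Prop :=
  forall X : 'rV[R]_n,
    [/\ smooth_curve (fun s => expG (s *: X)),
        forall s t, expG ((s + t) *: X) = lg_mul (expG (s *: X)) (expG (t *: X))
      & velocity (fun s => expG (s *: X)) 0 = X].

Definition Ad (g : G) (X : 'rV[R]_n) : 'rV[R]_n :=
  tangent_map (fun h => lg_mul (lg_mul g h) (lg_inv g)) (lg_one G) X.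

(* <coAd g xi, X> = <xi, Ad (g^-1) X> *)
Definition coAd (g : G) (xi : 'cV[R]_n) : 'cV[R]_n :=
  lin1_mx (Ad (lg_inv g)) *m xi.

(* Maximal abelian, with ad H semisimple (every invariant subspace has an
   invariant complement) for all H in h. *)
Definition cartan_subalgebra (h : {vspace 'rV[R]_n}) : Prop :=
  let abelian_subalgebra (a : {vspace 'rV[R]_n}) :=
    forall X Y, X \in a -> Y \in a -> lie_bracket X Y = 0 in
  let ad_stable (H : 'rV[R]_n) (V : {vspace 'rV[R]_n}) :=
    forall X, X \in V -> lie_bracket H X \in V in
  [/\ abelian_subalgebra h,
      forall a, abelian_subalgebra a -> (h <= a)%VS -> a = h &
      forall H, H \in h -> forall V, ad_stable H V ->
        exists W, [/\ ad_stable H W, (V + W)%VS = fullv & (V :&: W)%VS = 0%VS]].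

(* Twists are the t : 'M[R]_n of the form \sum_i wedge (X i) (Y i), i.e. the
   antisymmetric matrices; this is the subspace Lambda^2 h of those. *)
Definition Lambda2 (h : {vspace 'rV[R]_n}) (t : 'M[R]_n) : Prop :=
  exists (r : nat) (X Y : 'I_r -> 'rV[R]_n),
    (forall i, X i \in h /\ Y i \in h) /\ t = \sum_(i < r) wedge (X i) (Y i).

Section Actions.
Variables (m : nat) (M : manifold R m).
Variables (expG : 'rV[R]_n -> G) (sigma : G -> M -> M).

Definition fundamental_vector (X : 'rV[R]_n) (p : M) : 'rV[R]_m :=
  velocity (fun s => sigma (expG (s *: X)) p) 0.

(* Image of t under Lambda^2 of the linear map X |-> X_M,p; thus
   wedge X Y is sent to the wedge of X_M,p and Y_M,p. *)
Definition fundamental_bivector (t : 'M[R]_n) (p : M) : 'M[R]_m :=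
  let A := lin1_mx (fundamental_vector^~ p) in A^T *m t *m A.

Definition smooth_action : Prop :=
  [/\ smooth_map2 sigma,
      forall p, sigma (lg_one G) p = p &
      forall g h p, sigma (lg_mul g h) p = sigma g (sigma h p)].

Definition symplectomorphism (omega : M -> 'M[R]_m) (F : M -> M) : Prop :=
  [/\ smooth_map F, (exists2 F' : M -> M, cancel F F' /\ cancel F' F & smooth_map F') &
    forall p u v,
      (tangent_map F p u *m omega (F p) *m (tangent_map F p v)^T) 0 0 =
      (u *m omega p *m v^T) 0 0].

Definition moment_map (omega : M -> 'M[R]_m) (mu : M -> 'cV[R]_n) : Prop :=
  [/\ smooth_function mu,
      forall X p, differential (fun q => pairing X (mu q)) p =
                  contraction (fundamental_vector X p) (omega p) &
      forall g p, mu (sigma g p) = coAd g (mu p)].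

Definition symplectic_hamiltonian_action (omega : M -> 'M[R]_m) : Prop :=
  [/\ smooth_action,
      forall g, symplectomorphism omega (sigma g) &
      exists mu, moment_map omega mu].

Definition deforms (t : 'M[R]_n) (pi : M -> 'M[R]_m) : Prop :=
  let pi_t := fun p => pi p - fundamental_bivector t p in
  [/\ poisson_structure pi_t, nondegenerate pi_t &
      exists! omega_t, symplectic_form omega_t /\ induces omega_t pi_t].

End Actions.
End LieGroups.
End Manifolds.

(* Main.v *)
Require Import Defs.
From HB Require Import structures.
From mathcomp Require Import all_boot all_order all_algebra.
From mathcomp Require Import all_classical all_reals all_analysis.
From mathcomp Require Import ring.
Set Implicit Arguments.
Unset Strict Implicit.
Unset Printing Implicit Defensive.
Import Order.TTheory GRing.Theory Num.Theory.
Import numFieldNormedType.Exports.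
Local Open Scope classical_set_scope.
Local Open Scope ring_scope.

(** For t = sum_i X_i /\ Y_i put F_i = mu^{X_i}, K_i = mu^{Y_i} and let E be
    the matrix of sum_i dF_i /\ dK_i. Since X_M = pi^sharp (d mu^X), the field
    pi - t_M is pi + pi E pi. When all the X_i and Y_i commute, their moments
    Poisson-commute, so E pi E = 0 and (omega - E) (pi + pi E pi) = 1. Hence
    omega - sum_i dF_i /\ dK_i, which is visibly closed, is a symplectic form
    inducing pi - t_M, and the inverse of a symplectic form is always Poisson.

    That [X, Y] = 0 implies {mu^X, mu^Y} = 0 follows by differentiating the
    equivariance of mu along exp (-s X): the derivative of Ad (exp (s X)) Y at
    s = 0 is [X, Y], both being the antisymmetrized mixed second derivative of
    the multiplication in a chart at 1. *)

(** * Differential calculus of C^k maps *)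

Section Calculus.
Context {R : realType}.

(** Tensors at [p] are written in [chart_at p], a choice that need not be continuous in [p], so a
    field such as [differential f] cannot be differentiated as it stands. Second-order arguments
    therefore move to one fixed chart, where the same object is a smooth function on an open set.
    Smoothness is phrased with iterated directional derivatives, while the chain rule and linearity
    in the direction need total differentiability; this is what the detour through continuous
    partial derivatives provides.

    The map [expG] is controlled only along the lines s |-> sX. Linearity of X |-> X_M is therefore
    read off the moment map, mu^X being linear in X. Since only derivatives at s = 0 matter, all
    group elements can be kept in the chart at 1.

    The inverse of a symplectic form is Poisson because differentiating omega pi = 1 gives d_a pi =
    - pi (d_a omega) pi: up to a factor, [pi, pi] is d omega with its three indices raised by pi. *)

Lemma derivable_line (V W : normedModType R) (f : V -> W) (y v : V) (t : R) :
  derivable f (t *: v + y) v ->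
  is_derive t 1 (fun s => f (s *: v + y)) ('D_v f (t *: v + y)).
Proof.
move=> df; have E : (fun h : R => h^-1 *: (((fun s => f (s *: v + y)) \o shift t)
   (h *: 1) - f (t *: v + y))) =
   (fun h : R => h^-1 *: ((f \o shift (t *: v + y)) (h *: v) - f (t *: v + y))).
  by apply/funext => h /=; rewrite [h%:A]mulr1 scalerDl addrA.
by apply: DeriveDef; rewrite /derivable/derive E.
Qed.

(** Bounding [t] by [|c|] allows either sign of [c], so that any coordinate of an increment can be
    used as [c]. *)
Lemma MVT_dir (V : normedModType R) (f : V -> R) (y v : V) (c : R) :
  (forall t : R, `|t| <= `|c| -> derivable f (t *: v + y) v) ->
  exists2 t : R, `|t| <= `|c| & f (c *: v + y) - f y = c * 'D_v f (t *: v + y).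
Proof.
move=> df; pose g (s : R) : R^o := f (s *: v + y).
have dg (t : R) : `|t| <= `|c| -> is_derive t 1 g ('D_v f (t *: v + y)).
  by move=> /df; exact: derivable_line.
have cg (a b : R) : (forall t : R, t \in `[a, b] -> `|t| <= `|c|) ->
    {within `[a, b], continuous g}.
  move=> H; apply: derivable_within_continuous => t tab.
  by have [] := dg t (H t tab).
have g0 : g 0 = f y by rewrite /g scale0r add0r.
have [c0|c0] := leP 0 c.
- have H (t : R) : t \in `[0, c] -> `|t| <= `|c|.
    by rewrite in_itv/= => /andP[t0 tc]; rewrite !ger0_norm.
  have [|t tin E] := MVT_segment (df := fun t => 'D_v f (t *: v + y)) c0 _ (cg _ _ H).
    by move=> t /subset_itv_oo_cc tin; apply/dg/H.
  exists t; first exact: H.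
  by move: E; rewrite g0 subr0 mulrC /g.
- have H (t : R) : t \in `[c, 0] -> `|t| <= `|c|.
    rewrite in_itv/= => /andP[t0 tc]; rewrite !ler0_norm ?lerN2//.
    exact: ltW.
  have [|t tin E] := MVT_segment (df := fun t => 'D_v f (t *: v + y)) (ltW c0) _ (cg _ _ H).
    by move=> t /subset_itv_oo_cc tin; apply/dg/H.
  exists t; first exact: H.
  move: E; rewrite g0 sub0r /g => E.
  by rewrite -opprB E mulrN opprK mulrC.
Qed.

(* Telescope along the axes [b i], with one mean value step per axis. *)
Lemma partials_differentiable (V : normedModType R) (I : finType) (b : I -> V)
    (coef : I -> V -> R) (f : V -> R) (x : V) :
  (forall i, linear (coef i : V -> R^o)) ->
  (forall i, exists2 K : R, 0 < K & forall v, `|coef i v| <= K * `|v|) ->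
  (forall v, v = \sum_i coef i v *: b i) ->
  (forall i, \forall y \near x, derivable f y (b i)) ->
  (forall i, {for x, continuous (fun y => 'D_(b i) f y)}) ->
  differentiable f x.
Proof.
move=> lc bc dec df cf.
pose S (s : seq I) (h : V) := \sum_(i <- s) coef i h *: b i.
pose D (s : seq I) (h : V) : R^o := \sum_(i <- s) coef i h * 'D_(b i) f x.
have S0 : forall s, exists2 K : R, 0 < K & forall v, `|S s v| <= K * `|v|.
  elim=> [|i s [K K0 IH]].
    by exists 1 => // v; rewrite /S big_nil normr0 mul1r.
  have [L L0 HL] := bc i.
  exists (L * `|b i| + K) => [|v]; first by rewrite ltr_wpDl// mulr_ge0// ltW.
  rewrite /S big_cons (le_trans (ler_normD _ _))// mulrDl lerD ?IH//.
  by rewrite normrZ mulrAC ler_wpM2r.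
have P : forall s, forall e : R, 0 < e -> \forall h \near (0 : V),
    `|f (S s h + x) - f x - D s h| <= e * `|h|.
  elim=> [|i s IH] e e0.
    by near=> h; rewrite /S /D !big_nil add0r subrr subr0 normr0 mulr_ge0// ltW.
  have [K K0 HK] := bc i; have [L L0 HL] := S0 s.
  have e20 : 0 < e / 2 by rewrite divr_gt0.
  have eK : 0 < e / 2 / K by rewrite divr_gt0.
  have /cvgrPdist_le/(_ _ eK) nc := cf i.
  have /nbhs_ballP[d /= d0 Hd] : \forall y \near x, derivable f y (b i) /\
      `|'D_(b i) f x - 'D_(b i) f y| <= e / 2 / K by apply: filterI; [exact: df|exact: nc].
  (* [L] controls the part of the increment along the axes in [s] and [K * |b i|] the current step,
     so the whole segment of the mean value step stays in the ball where the partial derivative is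
     controlled. *)
  have M0 : 0 < L + K * `|b i| + 1.
    by rewrite ltr_wpDl// addr_ge0// ?mulr_ge0// ltW.
  near=> h.
  have hd : (L + K * `|b i| + 1) * `|h| < d.
    rewrite mulrC -ltr_pdivlMr//.
    near: h; apply: nbhs0_lt; exact: divr_gt0.
  have near_seg (t : R) : `|t| <= `|coef i h| ->
      ball x d (t *: b i + (S s h + x)).
    move=> tc; rewrite -ball_normE /ball_/=.
    rewrite distrC addrA addrK.
    apply: le_lt_trans hd; apply: (le_trans (ler_normD _ _)).
    rewrite mulrDl mul1r addrC ler_wpDr// mulrDl lerD// normrZ mulrAC.
    by rewrite ler_wpM2r// (le_trans tc).
  have [t tc E] := MVT_dir (fun t tc => (Hd _ (near_seg t tc)).1).
  have Et := (Hd _ (near_seg t tc)).2.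
  have -> : S (i :: s) h + x = coef i h *: b i + (S s h + x).
    by rewrite /S big_cons addrA.
  have -> : D (i :: s) h = coef i h * 'D_(b i) f x + D s h.
    by rewrite /D big_cons.
  have -> : f (coef i h *: b i + (S s h + x)) - f x -
      (coef i h * 'D_(b i) f x + D s h) =
     (f (S s h + x) - f x - D s h) +
     coef i h * ('D_(b i) f (t *: b i + (S s h + x)) - 'D_(b i) f x).
    by rewrite mulrBr -E; ring.
  rewrite (le_trans (ler_normD _ _))// [e in leRHS]splitr mulrDl lerD//.
    by near: h; exact: IH.
  rewrite normrM distrC.
  apply: le_trans (_ : (K * `|h|) * (e / 2 / K) <= _).
    by rewrite ler_pM.
  by rewrite mulrAC [K * _]mulrC divfK ?gt_eqF.
pose D1 : V -> R^o := D (index_enum I).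
have lD : linear D1.
  move=> a u v; rewrite /D1/D scaler_sumr -big_split/=; apply: eq_bigr => i _.
  by rewrite lc mulrDl scalerAl.
pose lin := GRing.isLinear.Build R V R^o _ D1 lD.
pose dF : {linear V -> R^o} := HB.pack D1 lin.
have cD : continuous dF.
  apply: bounded_linear_continuous; apply/ex_bound.
  (* The differential must be a continuous linear map; the bounds on the coordinate forms give a
     bound for it on the unit ball. *)
  pose Z := \sum_i (sval (cid2 (bc i))) * `|'D_(b i) f x|.
  exists Z; near=> v.
  have v1 : `|v| <= 1 by near: v; apply: nbhs0_le; exact: ltr01.
  apply: (le_trans (ler_norm_sum _ _ _)); apply: ler_sum => i _.
  rewrite normrM ler_wpM2r//; case: (cid2 (bc i)) => K K0 HK /=.
  apply: le_trans (HK _) _; by rewrite ler_piMr// ltW.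
have o : f \o shift x = cst (f x) + dF +o_ (0 : V) id.
  apply/eqaddoP => e e0; have := P (index_enum I) _ e0.
  by apply: filterS => h; rewrite -[S _ _]dec -addrA -opprD.
by apply/diff_locallyP; rewrite (diff_unique cD o); split.
Unshelve. all: by end_near.
Qed.

End Calculus.

(** * Chain rule, total differentiability and symmetry of second derivatives *)

Section Differentiability.
Context {R : realType}.

(** Directional derivability of [g] is enough: restricted to the line through [x] along [v] it
    becomes a curve, and in one real variable derivability is differentiability. *)
Lemma derive_comp (V1 V W : normedModType R) (f : V -> W) (g : V1 -> V) (x v : V1) :
  differentiable f (g x) -> derivable g x v ->
  is_derive x v (f \o g) ('D_('D_v g x) f (g x)).
Proof.
move=> df dg; pose k (h : R) := g (h *: v + x).
have k0 : k 0 = g x by rewrite /k scale0r add0r.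
have dk0 : is_derive (0 : R) 1 k ('D_v g x).
  have := @derivable_line R V1 V g x v 0.
  by rewrite scale0r add0r; apply.
have dk : differentiable k (0 : R) by apply/derivable1_diffP.
have dfk : differentiable f (k 0) by rewrite k0.
have dfg : derivable (f \o g) x v.
  apply/derivable1P; have : derivable (f \o k) 0 1; last by [].
  by apply/derivable1_diffP; exact: differentiable_comp.
apply: DeriveDef => //.
have := @derivable_line R V1 W (f \o g) x v 0.
rewrite scale0r add0r => /(_ dfg) [_ E].
have -> : 'D_v (f \o g) x = 'D_1 (f \o k) (0 : R) by rewrite -E.
rewrite deriveE; last exact: differentiable_comp.
rewrite diff_comp//= -(deriveE _ dk) derive_val.
by rewrite -deriveE k0 //.
Qed.

Lemma derive_linear (V W : normedModType R) (f : V -> W) (y : V) :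
  differentiable f y -> linear (fun v => 'D_v f y).
Proof. by move=> df a u v; rewrite !deriveE// linearP. Qed.

Lemma derive_sumZ (V W : normedModType R) (f : V -> W) (y : V) (I : Type)
    (s : seq I) (c : I -> R) (v : I -> V) :
  differentiable f y ->
  'D_(\sum_(i <- s) c i *: v i) f y = \sum_(i <- s) c i *: 'D_(v i) f y.
Proof.
move=> df; rewrite deriveE// linear_sum; apply: eq_bigr => i _.
by rewrite linearZ/= -deriveE.
Qed.

(** The data consumed by [partials_differentiable], in a form that passes to products: maps of two
    manifold variables live on a product of two row spaces. *)
Definition finite_dim (V : normedModType R) :=
  exists (I : finType) (b : I -> V) (coef : I -> V -> R),
    [/\ forall i, linear (coef i : V -> R^o),
        forall i, exists2 K : R, 0 < K & forall v, `|coef i v| <= K * `|v| &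
        forall v, v = \sum_i coef i v *: b i].

Lemma finite_dim_rV m : finite_dim 'rV[R]_m.
Proof.
exists 'I_m, (fun i => delta_mx 0 i), (fun i (v : 'rV[R]_m) => v 0 i); split.
- by move=> i a u v; rewrite !mxE.
- move=> i; exists 1 => // v; rewrite mul1r [leRHS]/Num.Def.normr/= mx_normrE.
  exact: (le_bigmax _ (fun ij => `|v ij.1 ij.2|) (0, i)).
- exact: row_sum_delta.
Qed.

Lemma finite_dim_prod (V W : normedModType R) :
  finite_dim V -> finite_dim W -> finite_dim (V * W)%type.
Proof.
move=> [I [b [c [lc bc dc]]]] [J [b' [c' [lc' bc' dc']]]].
exists (I + J)%type,
  (fun k => match k with inl i => (b i, 0) | inr j => (0, b' j) end : (V * W)%type),
  (fun k (v : V * W) => match k with inl i => c i v.1 | inr j => c' j v.2 end); split.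
- by case=> i a u v; [exact: lc|exact: lc'].
- case=> i.
    have [K K0 H] := bc i; exists K => // v; apply: le_trans (H _) _.
    by rewrite (ler_wpM2l (ltW K0))// prod_normE le_max lexx.
  have [K K0 H] := bc' i; exists K => // v; apply: le_trans (H _) _.
  by rewrite (ler_wpM2l (ltW K0))// prod_normE le_max lexx orbT.
- move=> [v w]; rewrite big_sumType/=.
  rewrite [X in X + _](_ : _ = (v, 0)).
    rewrite [X in _ + X](_ : _ = (0, w)).
      by congr (_, _) => /=; rewrite ?addr0 ?add0r.
    rewrite {2}(dc' w); elim/big_rec2: _ => //= j y1 y2 _ ->.
    by congr (_, _) => /=; rewrite scaler0 add0r.
  rewrite {2}(dc v); elim/big_rec2: _ => //= j y1 y2 _ ->.
  by congr (_, _) => /=; rewrite scaler0 add0r.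
Qed.

Lemma smooth_continuous (V W : normedModType R) (U : set V) (f : V -> W) x :
  smooth_on U f -> U x -> {for x, continuous f}.
Proof. by move=> /(_ 0)[c _]; exact: c. Qed.

Lemma smooth_derivable (V W : normedModType R) (U : set V) (f : V -> W) x v :
  smooth_on U f -> U x -> derivable f x v.
Proof. by move=> /(_ 1)[_ /(_ v)[d _]]; exact: d. Qed.

Lemma smooth_derive (V W : normedModType R) (U : set V) (f : V -> W) v :
  smooth_on U f -> smooth_on U (fun x => 'D_v f x).
Proof. by move=> sf k; have [_ /(_ v)[_ d]] := sf k.+1. Qed.

Lemma smooth_differentiable (V : normedModType R) (U : set V) (f : V -> R) x :
  finite_dim V -> open U -> smooth_on U f -> U x -> differentiable f x.
Proof.
move=> [I [b [coef [lc bc dec]]]] oU sf Ux.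
apply: (partials_differentiable lc bc dec) => i.
  have : nbhs x U by exact: open_nbhs_nbhs.
  by apply: filterS => y Uy; exact: smooth_derivable sf Uy.
exact: smooth_continuous (smooth_derive (b i) sf) Ux.
Qed.

(** A radius [e / 2 / (|v| + |w| + 1)] works: the [1] covers the case v = w = 0 and the [2] makes
    the inequality strict. *)
Lemma near_parallelogram (V : normedModType R) (x v w : V) (P : V -> Prop) :
  (\forall y \near x, P y) -> exists2 d : R, 0 < d &
  forall s t : R, `|s| <= d -> `|t| <= d -> P (s *: v + (t *: w + x)).
Proof.
move=> /nbhs_ballP[e /= e0 H].
have M0 : 0 < `|v| + `|w| + 1 by rewrite ltr_wpDl// addr_ge0.
exists (e / 2 / (`|v| + `|w| + 1)); first by rewrite !divr_gt0.
move=> s t sd td; apply: H; rewrite -ball_normE /ball_/= distrC addrA addrK.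
apply: le_lt_trans (_ : e / 2 < e); last by rewrite ltr_pdivrMr// mulr2n mulrDr mulr1 ltrDl.
rewrite (le_trans (ler_normD _ _))// !normrZ.
set d := _ / _ in sd td.
have d0 : 0 <= d by apply: le_trans sd.
apply: le_trans (_ : d * `|v| + d * `|w| <= _); first by rewrite lerD// ler_wpM2r.
rewrite -mulrDr; apply: le_trans (_ : d * (`|v| + `|w| + 1) <= _).
  by rewrite ler_wpM2l// lerDl.
by rewrite /d divfK// gt_eqF.
Qed.

(* Mean value theorem twice; the second difference itself is symmetric in [v]
   and [w]. *)
Lemma second_difference_bound (V : normedModType R) (f : V -> R) (x v w : V) (e : R) : 0 < e ->
  (\forall y \near x, derivable f y v) ->
  (\forall y \near x, derivable (fun y => 'D_v f y) y w) ->
  {for x, continuous (fun y => 'D_w (fun z => 'D_v f z) y)} ->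
  exists2 d : R, 0 < d & forall s, `|s| <= d ->
    `|f (s *: v + (s *: w + x)) - f (s *: v + x) - (f (s *: w + x) - f x)
      - s * (s * 'D_w (fun y => 'D_v f y) x)| <= s ^+ 2 * e.
Proof.
move=> e0 fv fvw c.
have /cvgrPdist_le/(_ _ e0) nc := c.
have [d1 d10 H1] := near_parallelogram v w fv.
have [d2 d20 H2] := near_parallelogram w v fvw.
have [d3 d30 H3] := near_parallelogram w v nc.
exists (Num.min d1 (Num.min d2 d3)); first by rewrite !lt_min d10 d20.
move=> s; rewrite !le_min => /and3P[s1 s2 s3].
(* The second difference is the increment of [g] along [v]; the mean value theorem along [w] is then
   applied to the derivative of [f] along [v]. *)
pose g y := f (s *: w + y) - f y.
have dg (t : R) : `|t| <= `|s| ->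
    is_derive (t *: v + x) v g
      ('D_v f (s *: w + (t *: v + x)) - 'D_v f (t *: v + x)).
  move=> ts.
  have dA : is_derive (t *: v + x) v (fun y => f (s *: w + y))
      ('D_v f (s *: w + (t *: v + x))).
    have -> : (fun y => f (s *: w + y)) = f \o (fun y => s *: w + y) by [].
    have D : derivable f (s *: w + (t *: v + x)) v.
      rewrite addrCA; apply: H1 => //; exact: le_trans s1.
    have E : (fun h : R => h^-1 *: (((f \o (fun y => s *: w + y)) \o shift (t *: v + x))
       (h *: v) - f (s *: w + (t *: v + x)))) =
      (fun h : R => h^-1 *: ((f \o shift (s *: w + (t *: v + x))) (h *: v) - f (s *: w + (t *: v + x)))).
      by apply/funext => h /=; rewrite addrCA.
    by apply: DeriveDef; rewrite /derivable/derive E.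
  have dB : is_derive (t *: v + x) v f ('D_v f (t *: v + x)).
    apply: DeriveDef => //.
    have := H1 t 0 (le_trans ts s1); rewrite scale0r add0r normr0; apply.
    exact: ltW.
  exact: is_deriveB.
have [t ts] := MVT_dir (fun t ts => @ex_derive _ _ _ _ _ _ _ (dg t ts)).
have [_ ->] := dg t ts.
have [|r rs ->] := @MVT_dir R V (fun y => 'D_v f y) (t *: v + x) w s.
  by move=> r rs; apply: H2; apply: le_trans s2.
rewrite /g [s *: w + (s *: v + x)]addrCA => ->.
rewrite -!mulrBr mulrA -expr2 normrM (ger0_norm (sqr_ge0 s)).
by rewrite ler_wpM2l ?sqr_ge0// distrC H3//; apply: le_trans s3.
Qed.

(** Both mixed derivatives, multiplied by [s ^+ 2], approximate the same second difference, each
    within [s ^+ 2 * (e / 2)]. *)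
Lemma schwarz (V : normedModType R) (U : set V) (f : V -> R) (x v w : V) :
  open U -> smooth_on U f -> U x ->
  'D_w (fun y => 'D_v f y) x = 'D_v (fun y => 'D_w f y) x.
Proof.
move=> oU sf Ux; have nU : \forall y \near x, U y by exact: open_nbhs_nbhs.
have nd (g : V -> R) u : smooth_on U g -> \forall y \near x, derivable g y u.
  by move=> sg; apply: filterS nU => y; exact: smooth_derivable sg.
have aux v' w' e (e0 : 0 < e) := @second_difference_bound V f x v' w' e e0 (nd _ v' sf)
  (nd _ w' (smooth_derive v' sf))
  (smooth_continuous (smooth_derive w' (smooth_derive v' sf)) Ux).
apply/eqP; rewrite -subr_eq0 -normr_le0; apply/ler_addgt0Pl => e e0; rewrite addr0.
have e20 : 0 < e / 2 by rewrite divr_gt0.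
have [d d0 H] := aux v w _ e20; have [d' d'0 H'] := aux w v _ e20.
pose s := Num.min d d'.
have s0 : 0 < s by rewrite lt_min d0.
have Es : `|s| = s by rewrite gtr0_norm.
have /H {}H : `|s| <= d by rewrite Es ge_min lexx.
have /H' {}H' : `|s| <= d' by rewrite Es ge_min lexx orbT.
have s20 : 0 < s ^+ 2 by rewrite exprn_gt0.
rewrite -(ler_pM2l s20) -[s ^+ 2 in leLHS]gtr0_norm// -normrM [e]splitr [leRHS]mulrDr.
apply: le_trans (lerD H' H); rewrite -[X in _ <= _ + X]normrN.
apply: le_trans (ler_normD _ _); rewrite le_eqVlt; apply/orP; left; apply/eqP.
congr (`| _ |); rewrite [s *: w + (s *: v + x)]addrCA.
by generalize (f (s *: v + (s *: w + x))), (f (s *: w + x)), (f (s *: v + x)), (f x),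
  ('D_w (fun y => 'D_v f y) x), ('D_v (fun y => 'D_w f y) x) => F p q r A B; ring.
Qed.

End Differentiability.

(** * Closure properties of C^k maps on an open set *)

Section Smooth.
Context {R : realType} {V : normedModType R} (U : set V).
Hypothesis oU : open U.

Lemma open_near x : U x -> \forall y \near x, U y.
Proof. by move=> Ux; exact: open_nbhs_nbhs. Qed.

Lemma near_eq_continuous (T : topologicalType) (T' : topologicalType)
    (f g : T -> T') x :
  {near x, f =1 g} -> {for x, continuous f} -> {for x, continuous g}.
Proof.
move=> fg cf; rewrite /prop_for /continuous_at -(nbhs_singleton fg).
by apply: cvg_trans cf; apply: near_eq_cvg; apply: filterS fg => y ->.
Qed.

(** On an open set, agreement on [U] is agreement near each of its points, so all derivatives agree
    as well. *)
Lemma Ck_ext (W : normedModType R) k (f g : V -> W) :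
  (forall x, U x -> f x = g x) -> Ck k U f -> Ck k U g.
Proof.
have H (f' g' : V -> W) : (forall x, U x -> f' x = g' x) ->
    forall x, U x -> {near x, f' =1 g'}.
  by move=> fg x Ux; apply: filterS (open_near Ux).
elim: k f g => [|k IH] f g fg [cf df]; split.
- by move=> x Ux; apply: near_eq_continuous (H _ _ fg _ Ux) (cf x Ux).
- by [].
- by move=> x Ux; apply: near_eq_continuous (H _ _ fg _ Ux) (cf x Ux).
- move=> v; have [dfv cfv] := df v; split.
    by move=> x Ux; apply: near_eq_derivable (H _ _ fg _ Ux) (dfv x Ux).
  apply: IH cfv => x Ux; apply: near_eq_derive; exact: H.
Qed.

Lemma Ck_succ (W : normedModType R) k (f : V -> W) : Ck k.+1 U f -> Ck k U f.
Proof.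
elim: k f => [|k IH] f [cf df]; split => // v.
have [dfv cfv] := df v; split => //; exact: IH.
Qed.

Lemma Ck_cst (W : normedModType R) k (a : W) : Ck k U (fun=> a).
Proof.
elim: k a => [|k IH] a; split=> //; try by move=> x _; exact: cvg_cst.
move=> v; split=> [x _|]; first exact: derivable_cst.
by apply: Ck_ext (IH 0) => x _; rewrite derive_cst.
Qed.

Lemma Ck_add (W : normedModType R) k (f g : V -> W) :
  Ck k U f -> Ck k U g -> Ck k U (fun x => f x + g x).
Proof.
elim: k f g => [|k IH] f g [cf df] [cg dg]; split => //.
- by move=> x Ux; apply: continuousD; [exact: cf|exact: cg].
- by move=> x Ux; apply: continuousD; [exact: cf|exact: cg].
move=> v; have [dfv cfv] := df v; have [dgv cgv] := dg v; split.
  by move=> x Ux; apply: derivableD; [exact: dfv|exact: dgv].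
apply: Ck_ext (IH _ _ cfv cgv) => x Ux.
by rewrite -deriveD//; [exact: dfv|exact: dgv].
Qed.

Lemma Ck_mul k (f g : V -> R) :
  Ck k U f -> Ck k U g -> Ck k U (fun x => f x * g x).
Proof.
elim: k f g => [|k IH] f g; first by
  move=> [cf _] [cg _]; split => // x Ux; apply: continuousM; [exact: cf|exact: cg].
move=> Cf Cg; have [cf df] := Cf; have [cg dg] := Cg; split.
  by move=> x Ux; apply: continuousM; [exact: cf|exact: cg].
move=> v; have [dfv cfv] := df v; have [dgv cgv] := dg v; split.
  by move=> x Ux; apply: derivableM; [exact: dfv|exact: dgv].
apply: Ck_ext (Ck_add (IH _ _ (Ck_succ Cf) cgv) (IH _ _ (Ck_succ Cg) cfv)) => x Ux.
by rewrite -[RHS]/('D_v (f * g) x) deriveM//; [exact: dfv|exact: dgv].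
Qed.

Lemma Ck_inv k (f : V -> R) : (forall x, U x -> f x != 0) ->
  Ck k U f -> Ck k U (fun x => (f x)^-1).
Proof.
(* The induction keeps [f] fixed: the derivative - f^-2 f' involves f^-1 only at the previous
   order. *)
move=> f0; elim: k => [[cf _]|k IH Cf].
  by split => // x Ux; apply: continuousV; [exact: f0|exact: cf].
have [cf df] := Cf; split.
  by move=> x Ux; apply: continuousV; [exact: f0|exact: cf].
move=> v; have [dfv cfv] := df v; split.
  by move=> x Ux; apply: derivableV; [exact: f0|exact: dfv].
have Cv := IH (Ck_succ Cf).
have CN : Ck k U (fun=> -1 : R) by exact: Ck_cst.
apply: Ck_ext (Ck_mul (Ck_mul CN (Ck_mul Cv Cv)) cfv) => x Ux.
rewrite deriveV//; [|exact: f0|exact: dfv].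
by rewrite -exprVn expr2 mulN1r.
Qed.

Lemma Ck_sum (W : normedModType R) k (I : Type) (s : seq I) (P : pred I) (f : I -> V -> W) :
  (forall i, P i -> Ck k U (f i)) -> Ck k U (fun x => \sum_(i <- s | P i) f i x).
Proof.
move=> Cf; elim: s => [|i s IH].
  by apply: Ck_ext (Ck_cst k 0) => x _; rewrite big_nil.
case Pi : (P i); last by apply: Ck_ext IH => x _; rewrite big_cons Pi.
by apply: Ck_ext (Ck_add (Cf i Pi) IH) => x _; rewrite big_cons Pi.
Qed.

Lemma Ck_prod k (I : Type) (s : seq I) (f : I -> V -> R) :
  (forall i, Ck k U (f i)) -> Ck k U (fun x => \prod_(i <- s) f i x).
Proof.
move=> Cf; elim: s => [|i s IH].
  by apply: (@Ck_ext _ _ (fun=> 1 : R)); [move=> x _; rewrite big_nil|exact: Ck_cst].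
by apply: Ck_ext (Ck_mul (Cf i) IH) => x _; rewrite big_cons.
Qed.

Lemma continuous_mxP (T : topologicalType) m n (f : T -> 'M[R]_(m, n)) x :
  {for x, continuous f} <-> forall i j, {for x, continuous (fun y => f y i j)}.
Proof.
split=> [cf i j|cf].
  by apply: (@continuous_comp _ _ _ f (fun M : 'M[R]_(m, n) => M i j)) => //;
    exact: coord_continuous.
apply/cvgrPdist_le => e e0; near=> y.
rewrite [leLHS]/Num.Def.normr/= mx_normrE (bigmax_le _ (ltW e0))//= => i _.
rewrite !mxE; move: i; near: y; apply: filter_forall => /= i.
by have /cvgrPdist_le := cf i.1 i.2; exact.
Unshelve. all: by end_near. Qed.

Lemma Ck_mxP k m n (f : V -> 'M[R]_(m, n)) :
  Ck k U f <-> forall i j, Ck k U (fun x => f x i j).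
Proof.
elim: k f => [|k IH] f; split.
- by move=> [cf _] i j; split => // x Ux; have /continuous_mxP := cf x Ux.
- by move=> cf; split => // x Ux; apply/continuous_mxP => i j; have [+ _] := cf i j; exact.
- move=> [cf df] i j; split.
    by move=> x Ux; have /continuous_mxP := cf x Ux.
  move=> v; have [dfv /IH cfv] := df v; split.
    by move=> x Ux; have /derivable_mxP := dfv x Ux.
  apply: Ck_ext (cfv i j) => x Ux.
  by rewrite derive_mx ?mxE//; exact: dfv.
- move=> cf; split.
    by move=> x Ux; apply/continuous_mxP => i j; have [+ _] := cf i j; exact.
  move=> v.
  have dfv x : U x -> derivable f x v.
    by move=> Ux; apply/derivable_mxP => i j; have [_ /(_ v)[+ _]] := cf i j; exact.
  split=> //; apply/IH => i j; have [_ /(_ v)[_ ]] := cf i j.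
  by apply: Ck_ext => x Ux; rewrite derive_mx ?mxE//; exact: dfv.
Qed.

Lemma Ck_mulmx k m n p (f : V -> 'M[R]_(m, n)) (g : V -> 'M[R]_(n, p)) :
  Ck k U f -> Ck k U g -> Ck k U (fun x => f x *m g x).
Proof.
move=> /Ck_mxP Cf /Ck_mxP Cg; apply/Ck_mxP => i j.
apply: (@Ck_ext _ _ (fun x => \sum_l f x i l * g x l j)); first by move=> x _; rewrite mxE.
by apply: Ck_sum => l _; apply: Ck_mul.
Qed.

Lemma Ck_trmx k m n (f : V -> 'M[R]_(m, n)) :
  Ck k U f -> Ck k U (fun x => (f x)^T).
Proof.
move=> /Ck_mxP Cf; apply/Ck_mxP => i j.
by apply: Ck_ext (Cf j i) => x _; rewrite mxE.
Qed.

Lemma Ck_opp k m n (f : V -> 'M[R]_(m, n)) : Ck k U f -> Ck k U (fun x => - f x).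
Proof.
move=> /Ck_mxP Cf; apply/Ck_mxP => i j.
have CN : Ck k U (fun=> -1 : R) by exact: Ck_cst.
by apply: Ck_ext (Ck_mul CN (Cf i j)) => x _; rewrite mxE mulN1r.
Qed.

Lemma Ck_det k n (f : V -> 'M[R]_n) : Ck k U f -> Ck k U (fun x => \det (f x)).
Proof.
move=> /Ck_mxP Cf; apply: Ck_sum => s _; apply: Ck_mul; first exact: Ck_cst.
exact: Ck_prod.
Qed.

(** Cramer's rule: each entry is a cofactor, polynomial in the entries of [f], divided by the
    determinant. *)
Lemma Ck_invmx k n (f : V -> 'M[R]_n) : (forall x, U x -> f x \in unitmx) ->
  Ck k U f -> Ck k U (fun x => invmx (f x)).
Proof.
move=> fu Cf; apply/Ck_mxP => i j.
apply: (@Ck_ext _ _ (fun x => (\det (f x))^-1 *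
    ((-1) ^+ (j + i) * \det (row' j (col' i (f x)))))).
  by move=> x Ux; rewrite /invmx fu// !mxE.
apply: Ck_mul.
  by apply: Ck_inv (Ck_det Cf) => x Ux; rewrite -unitfE; exact: fu.
apply: Ck_mul; first exact: Ck_cst.
apply: Ck_det; apply/Ck_mxP => a b; have /Ck_mxP/(_ (lift j a) (lift i b)) := Cf.
by apply: Ck_ext => x _; rewrite !mxE.
Qed.

End Smooth.

Lemma is_derive_mulmx (R : realType) (V : normedModType R) m n p
    (f : V -> 'M[R]_(m, n)) (g : V -> 'M[R]_(n, p)) x v :
  derivable f x v -> derivable g x v ->
  is_derive x v (fun y => f y *m g y) ('D_v f x *m g x + f x *m 'D_v g x).
Proof.
move=> df dg.
have dfE i j : derivable (fun y => f y i j) x v by have /derivable_mxP := df.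
have dgE i j : derivable (fun y => g y i j) x v by have /derivable_mxP := dg.
have E i j : (fun y => (f y *m g y) i j) =
    \sum_(l < n) (fun y => f y i l) * (fun y => g y l j).
  by apply/funext => y; rewrite mxE fct_sumE.
have D i j : derivable (fun y => (f y *m g y) i j) x v.
  by rewrite E; apply: derivable_sum => l; exact: derivableM.
apply: DeriveDef; first exact/derivable_mxP.
rewrite derive_mx; last exact/derivable_mxP.
apply/matrixP => i j; rewrite !mxE E derive_sum; last by move=> l; exact: derivableM.
rewrite -big_split/=; apply: eq_bigr => l _; rewrite deriveM//.
rewrite (derive_mx df) (derive_mx dg) !mxE [LHS]addrC.
by congr (_ + _); exact: mulrC.
Qed.

Lemma derive_entry (R : realType) (V : normedModType R) m n
    (f : V -> 'M[R]_(m, n)) x v i j :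
  derivable f x v -> 'D_v (fun y => f y i j) x = 'D_v f x i j.
Proof. by move=> df; rewrite (derive_mx df) mxE. Qed.

Lemma derive_antisym (R : realType) (V : normedModType R) m
    (f : V -> 'M[R]_m) x v :
  (forall y, (f y)^T = - f y) -> derivable f x v -> ('D_v f x)^T = - 'D_v f x.
Proof.
move=> fT df; apply/matrixP => i j; rewrite !mxE -!derive_entry//.
have -> : (fun y => f y j i) = - (fun y => f y i j).
  by apply/funext => y; move/matrixP/(_ i j): (fT y); rewrite !mxE.
by rewrite deriveN//; have /derivable_mxP := df.
Qed.

Lemma derive_mulr (R : realType) (V : normedModType R) (f g : V -> R) x v :
  derivable f x v -> derivable g x v ->
  'D_v (f * g) x = 'D_v f x * g x + f x * 'D_v g x.
Proof. by move=> df dg; rewrite deriveM// addrC; congr (_ + _); exact: mulrC. Qed.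

(** * Charts *)

Section Charts.
Context {R : realType} {m : nat} {M : manifold R m}.
Implicit Types (c d e : chart R m M) (p q : M).

Lemma atlas_chart_at p : atlas M (chart_at p).
Proof. by rewrite /chart_at; case: cid => c []. Qed.

Lemma dom_chart_at p : dom (chart_at p) p.
Proof. by rewrite /chart_at; case: cid => c []. Qed.

Lemma pt_img c u : (crd c @` dom c) u -> dom c (pt c u).
Proof. by move=> [x dx <-]; rewrite crdK. Qed.

Lemma crd_pt c u : (crd c @` dom c) u -> crd c (pt c u) = u.
Proof. by move=> [x dx <-]; rewrite crdK. Qed.

Lemma near_img c p : dom c p -> \forall u \near crd c p, (crd c @` dom c) u.
Proof.
move=> dp; apply: open_nbhs_nbhs; split; first exact: img_open.
by exists p.
Qed.

Lemma near_dom c p : dom c p -> \forall q \near p, dom c q.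
Proof. by move=> dp; apply: open_nbhs_nbhs; split; [exact: dom_open|]. Qed.

Lemma near_pt c p (A : M -> Prop) : dom c p -> (\forall q \near p, A q) ->
  \forall u \near crd c p, A (pt c u).
Proof.
move=> dp nA; have : {for crd c p, continuous (pt c)}.
  by apply: pt_continuous; exists p.
by apply; rewrite crdK.
Qed.

Lemma open_img c (A : set M) : open A -> A `<=` dom c -> open (crd c @` A).
Proof.
move=> oA Ac; rewrite openE => _ [p Ap <-]; rewrite /interior.
have dp := Ac _ Ap.
have nA : \forall q \near p, A q by exact: open_nbhs_nbhs.
apply: filterS2 (near_img dp) (near_pt dp nA) => u iu Au.
by exists (pt c u) => //; rewrite crd_pt.
Qed.

Lemma transition_derivable c d p v : atlas M c -> atlas M d -> dom c p -> dom d p ->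
  derivable (crd d \o pt c) (crd c p) v.
Proof.
move=> ac ad cp dp; apply: smooth_derivable (atlas_compat ac ad) _.
by exists p.
Qed.

Lemma transition_differentiable c d p j :
  atlas M c -> atlas M d -> dom c p -> dom d p ->
  differentiable ((fun q => crd d q 0 j) \o pt c) (crd c p).
Proof.
move=> ac ad cp dp.
apply: (@smooth_differentiable _ _ (crd c @` (dom c `&` dom d))).
- exact: finite_dim_rV.
- by apply: open_img; [apply: openI; exact: dom_open|exact: subIsetl].
- by move=> k; have /Ck_mxP := atlas_compat ac ad k;
    apply; apply: open_img; [apply: openI; exact: dom_open|exact: subIsetl].
- by exists p.
Qed.

Definition gradient (k : nat) (h : 'rV[R]_k -> R) (u : 'rV[R]_k) : 'cV[R]_k :=
  \col_i 'D_(delta_mx 0 i) h u.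

Lemma derive_gradient k (h : 'rV[R]_k -> R) u v :
  differentiable h u -> 'D_v h u = pairing v (gradient h u).
Proof.
move=> dh; rewrite {1}(row_sum_delta v) derive_sumZ// /pairing mxE.
by apply: eq_bigr => i _; rewrite mxE.
Qed.

(** [differential f p] is the case [c := chart_at p]. With [c] fixed while [p] moves, the result can
    be differentiated again. *)
Definition chart_gradient (f : M -> R) c p : 'cV[R]_m :=
  gradient (f \o pt c) (crd c p).

Lemma differentialE f p : differential f p = chart_gradient f (chart_at p) p.
Proof. by []. Qed.

Lemma chart_gradient_change c d p (f : M -> R) :
  atlas M c -> atlas M d -> dom c p -> dom d p ->
  differentiable (f \o pt d) (crd d p) ->
  chart_gradient f c p = chart_change c d p *m chart_gradient f d p.
Proof.
move=> ac ad cp dp df; apply/colP => i; rewrite !mxE.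
have E : \forall u \near crd c p, (f \o pt c) u = ((f \o pt d) \o (crd d \o pt c)) u.
  by apply: filterS (near_pt cp (near_dom dp)) => u du /=; rewrite crdK.
rewrite (near_eq_derive _ E).
have Ep : (crd d \o pt c) (crd c p) = crd d p by rewrite /= crdK.
have [|_ ->] := @derive_comp _ _ _ _ (f \o pt d) (crd d \o pt c) (crd c p) (delta_mx 0 i)
  _ (transition_derivable ac ad cp dp).
  by rewrite Ep.
rewrite Ep derive_gradient// /pairing mxE; apply: eq_bigr => j _.
by rewrite !mxE.
Qed.

Lemma chart_gradient_crd c d p j : atlas M c -> atlas M d -> dom c p -> dom d p ->
  chart_gradient (fun q => crd d q 0 j) c p = col j (chart_change c d p).
Proof.
move=> ac ad cp dp; apply/colP => i; rewrite !mxE.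
by rewrite derive_mx ?mxE//; exact: transition_derivable.
Qed.

Lemma chart_change_id c p : dom c p -> chart_change c c p = 1%:M.
Proof.
move=> cp; apply/matrixP => i j; rewrite !mxE.
rewrite (@near_eq_derive _ _ _ _ id) ?derive_id ?mxE 1?eq_sym//.
by apply: filterS (near_img cp) => u iu /=; rewrite crd_pt.
Qed.

(** Column by column, this is the transformation law of differentials applied to the coordinate
    functions of [e]. *)
Lemma chart_change_trans c d e p : atlas M c -> atlas M d -> atlas M e ->
  dom c p -> dom d p -> dom e p ->
  chart_change c d p *m chart_change d e p = chart_change c e p.
Proof.
move=> ac ad ae cp dp ep; apply/matrixP => i j.
have := @chart_gradient_change c d p (fun q => crd e q 0 j) ac ad cp dp
  (transition_differentiable j ad ae dp ep).
rewrite !chart_gradient_crd// => /colP/(_ i); rewrite !mxE => ->.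
by apply: eq_bigr => k _; rewrite !mxE.
Qed.

Lemma chart_change_inv c d p : atlas M c -> atlas M d -> dom c p -> dom d p ->
  chart_change c d p *m chart_change d c p = 1%:M.
Proof. by move=> *; rewrite chart_change_trans// chart_change_id. Qed.

Lemma smooth_function_differentiable c p (f : M -> R) : atlas M c -> dom c p ->
  smooth_function f -> differentiable (f \o pt c) (crd c p).
Proof.
move=> ac cp sf; apply: smooth_differentiable (sf c ac) _.
- exact: finite_dim_rV.
- exact: img_open.
- by exists p.
Qed.

End Charts.

(** * Inverses of symplectic forms *)

Section Poisson.
Context {R : realType} {m : nat}.

(** If [D a] are the partial derivatives of a form with inverse [P], then [- (P *m D a *m P)] is the
    derivative of [P], and the cyclic sum is half a coefficient of the Schouten bracket [P, P]. It
    equals, up to sign, the contraction of the exterior derivative with three copies of [P]. *)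
Lemma inverse_cyclic_sum (D : 'I_m -> 'M[R]_m) (P : 'M[R]_m) (i j k : 'I_m) :
  P^T = - P -> (forall a, (D a)^T = - D a) ->
  (forall a b d, D a b d - D b a d + D d a b = 0) ->
  let T i j k := \sum_a - (P *m D a *m P) i j * P a k in
  T i j k + T j k i + T k i j = 0.
Proof.
move=> PT DT Dcl T.
have PN a b : P a b = - P b a by move/matrixP/(_ b a): PT; rewrite !mxE.
have DN a b d : D a b d = - D a d b by move/matrixP/(_ d b): (DT a); rewrite !mxE.
have TE x y z : T x y z = - \sum_a \sum_b \sum_d P x b * P y d * P z a * D a b d.
  rewrite /T -sumrN; apply: eq_bigr => a _; rewrite mxE mulNr mulr_suml; congr (- _).
  rewrite exchange_big/=; apply: eq_bigr => d _; rewrite mxE !mulr_suml.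
  apply: eq_bigr => b _; rewrite (PN d y) (PN a z); ring.
(* The summation indices are renamed so that the three cyclic terms carry the same product of
   entries of [P]; closedness at (a, b, d) then cancels the remaining factors. *)
have T2 : T j k i = - \sum_a \sum_b \sum_d P i b * P j d * P k a * D b d a.
  rewrite TE exchange_big/= ; congr (- _).
  under eq_bigr do rewrite exchange_big/=.
  rewrite exchange_big/=; apply: eq_bigr => a _; rewrite exchange_big/=.
  apply: eq_bigr => b _; apply: eq_bigr => d _; ring.
have T3 : T k i j = - \sum_a \sum_b \sum_d P i b * P j d * P k a * D d a b.
  rewrite TE exchange_big/= ; congr (- _); apply: eq_bigr => a _.
  rewrite exchange_big/=; apply: eq_bigr => b _; apply: eq_bigr => d _; ring.
rewrite T2 T3 TE -!opprD -!big_split big1 ?oppr0//= => a _.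
rewrite -!big_split big1//= => b _; rewrite -!big_split big1//= => d _.
by rewrite -!mulrDr (DN b d a) Dcl mulr0.
Qed.

Context {M : manifold R m}.
Variables (omega pi : M -> 'M[R]_m).

Lemma inducesP :
  induces omega pi <-> forall p, omega p *m pi p = 1%:M.
Proof.
split=> [ind p|H p v]; last by rewrite /sharp /Defs.contraction trmxK -mulmxA H mulmx1.
apply/row_matrixP => i; rewrite !rowE mulmx1.
by have := ind p (delta_mx 0 i); rewrite /sharp /Defs.contraction trmxK mulmxA.
Qed.

Hypothesis inv : forall p, omega p *m pi p = 1%:M.

(** The form changes by congruence with the chart change and the bivector by congruence with its
    inverse, so the inner factors cancel. *)
Lemma chart_inverse c u : atlas M c -> (crd c @` dom c) u ->
  form_in_chart omega c u *m bivector_in_chart pi c u = 1%:M.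
Proof.
move=> ac iu; rewrite /form_in_chart /bivector_in_chart.
set p := pt c u; have cp : dom c p by exact: pt_img.
have [aq dq] := (atlas_chart_at p, dom_chart_at p).
rewrite !mulmxA -[X in X *m pi p]mulmxA -trmx_mul chart_change_inv// trmx1 mulmx1.
by rewrite -[X in X *m _]mulmxA inv mulmx1 chart_change_inv.
Qed.

(** Throughout the domain of [c], brackets of its coordinates are entries of one matrix function, so
    the nested brackets in [schouten] become derivatives of that function. *)
Lemma biderivation_crd c p i j : atlas M c -> dom c p ->
  biderivation pi (fun q => crd c q 0 i) (fun q => crd c q 0 j) p =
  bivector_in_chart pi c (crd c p) i j.
Proof.
move=> ac cp; rewrite /biderivation /bivector_in_chart !differentialE.
rewrite crdK// !chart_gradient_crd//; try exact: atlas_chart_at; try exact: dom_chart_at.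
by rewrite tr_col -!row_mul colE mulmxA -colE [LHS]mxE [LHS]mxE.
Qed.

Lemma symplectic_inverse_poisson : symplectic_form omega -> poisson_structure pi.
Proof.
move=> [[oT os] ocl _].
have inv' p : pi p *m omega p = 1%:M by apply: mulmx1C.
have piT p : (pi p)^T = - pi p.
  have H : - (pi p)^T *m omega p = 1%:M.
    by rewrite mulNmx -mulmxN -oT -trmx_mul inv trmx1.
  rewrite -[LHS]opprK; congr (- _).
  by rewrite -[LHS]mulmx1 -(inv p) mulmxA H mul1mx.
have sP c : atlas M c -> smooth_on (crd c @` dom c) (bivector_in_chart pi c).
  (* Smoothness of [pi] comes from that of [omega], by inverting its matrix in the chart. *)
  move=> ac k; have oi := @img_open _ _ _ c.
  have E u : (crd c @` dom c) u -> invmx (form_in_chart omega c u) = bivector_in_chart pi c u.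
    move=> iu; have E := chart_inverse ac iu; have [fu _] := mulmx1_unit E.
    by rewrite -[RHS]mul1mx -(mulVmx fu) -mulmxA E mulmx1.
  apply: (Ck_ext oi E); apply: Ck_invmx => //; last exact: os.
  by move=> u iu; have [] := mulmx1_unit (chart_inverse ac iu).
split=> // p i j k; pose c := chart_at p.
have [ac cp] := (atlas_chart_at p : atlas M c, dom_chart_at p : dom c p).
pose x l : M -> R := fun q => crd c q 0 l.
pose W := form_in_chart omega c; pose P := bivector_in_chart pi c.
pose u0 := crd c p.
have iu0 : (crd c @` dom c) u0 by exists p.
have Wu0 : W u0 = omega p.
  by rewrite /W /form_in_chart /u0 crdK// chart_change_id// trmx1 mulmx1 mul1mx.
have Pu0 : P u0 = pi p.
  by rewrite /P /bivector_in_chart /u0 crdK// chart_change_id// trmx1 mulmx1 mul1mx.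
have dW v : derivable W u0 v by exact: smooth_derivable (os c ac) iu0.
have dP v : derivable P u0 v by exact: smooth_derivable (sP c ac) iu0.
pose D a := 'D_(delta_mx 0 a) W u0.
pose DP a := 'D_(delta_mx 0 a) P u0.
(* Derivative of the constant product [W *m P] at [u0]. *)
have DPE a : DP a = - (pi p *m D a *m pi p).
  have E : D a *m pi p + omega p *m DP a = 0.
    have [_] := is_derive_mulmx (dW (delta_mx 0 a)) (dP (delta_mx 0 a)).
    rewrite Wu0 Pu0 => <-.
    rewrite (@near_eq_derive _ _ _ _ (fun=> 1%:M)) ?derive_cst//.
    by apply: filterS (near_img cp) => u iu; rewrite chart_inverse.
  rewrite -[LHS]mul1mx -(inv' p) -mulmxA -mulmxA -mulmxN.
  by congr (_ *m _); apply/eqP; rewrite -subr_eq0 opprK addrC E.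
have TE a b l : biderivation pi (biderivation pi (x a) (x b)) (x l) p =
    \sum_e DP e a b * pi p e l.
  rewrite /biderivation -/(biderivation pi (x a) (x b)).
  rewrite [X in _ *m X]differentialE chart_gradient_crd// chart_change_id//.
  rewrite -mulmxA mxE; apply: eq_bigr => e _; congr (_ * _); last first.
    by rewrite colE mul1mx -colE mxE.
  rewrite !mxE /DP (derive_mx (dP _)) mxE.
  apply: near_eq_derive; apply: filterS (near_img cp) => u iu.
  by rewrite [LHS]/= -[X in X = _]/(biderivation pi (x a) (x b) (pt c u))
    biderivation_crd ?crd_pt//; exact: pt_img.
have := @inverse_cyclic_sum D (pi p) i j k (piT p).
rewrite /schouten /schouten_on -/c !TE.
have SE a b l : \sum_e DP e a b * pi p e l = \sum_e - (pi p *m D e *m pi p) a b * pi p e l.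
  by apply: eq_bigr => e _; rewrite DPE mxE.
(* Each term occurs twice because both arguments of the Schouten bracket are [pi]. *)
move=> /= H; rewrite !SE -!mulr2n -!mulrnDl H ?mul0rn//.
- move=> a; apply: derive_antisym => // u.
  by rewrite /W /form_in_chart !trmx_mul trmxK oT mulNmx mulmxN mulmxA.
- move=> a b d; have E a' b' d' : D a' b' d' =
      'D_(delta_mx 0 a') (fun u => form_in_chart omega c u b' d') u0.
    by rewrite (derive_entry b' d' (dW _)).
  by clearbody D; rewrite !E; apply: ocl.
Qed.

Lemma inverse_nondegenerate : Defs.nondegenerate pi.
Proof.
move=> p; have inv' : pi p *m omega p = 1%:M by apply: mulmx1C.
exists (fun v => (v *m omega p)^T) => v; rewrite /sharp.
  by rewrite -mulmxA inv' mulmx1 trmxK.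
by rewrite trmxK -mulmxA inv mulmx1.
Qed.

End Poisson.

(** * The deformed symplectic form *)

Section Twist.
Context {R : realType} {m r : nat} {M : manifold R m}.
Variables (omega : M -> 'M[R]_m) (F K : 'I_r -> M -> R).
Hypotheses (sF : forall i, smooth_function (F i)) (sK : forall i, smooth_function (K i)).

(** The 2-form a /\ b in the convention omega(u, v) = u omega v^T; covectors being columns, the
    transposes sit opposite to those of [wedge]. *)
Definition covector_wedge (k : nat) (a b : 'cV[R]_k) : 'M[R]_k :=
  a *m b^T - b *m a^T.

Definition twisted_form (p : M) : 'M[R]_m :=
  omega p - \sum_i covector_wedge (differential (F i) p) (differential (K i) p).

Let dpart c (u : 'rV[R]_m) : 'M[R]_m :=
  \sum_i covector_wedge (gradient (F i \o pt c) u) (gradient (K i \o pt c) u).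

Lemma covector_wedgeM k (J : 'M[R]_k) a b :
  J *m covector_wedge a b *m J^T = covector_wedge (J *m a) (J *m b).
Proof. by rewrite /covector_wedge mulmxBr mulmxBl !trmx_mul !mulmxA. Qed.

Lemma twisted_form_in_chart c u : atlas M c -> (crd c @` dom c) u ->
  form_in_chart twisted_form c u = form_in_chart omega c u - dpart c u.
Proof.
move=> ac iu; have cp := pt_img iu; rewrite /form_in_chart /twisted_form.
have [aq dq] := (atlas_chart_at (pt c u), dom_chart_at (pt c u)).
rewrite mulmxBr mulmxBl; congr (_ - _).
rewrite mulmx_sumr mulmx_suml; apply: eq_bigr => i _.
have E (f : M -> R) : smooth_function f ->
    chart_change c (chart_at (pt c u)) (pt c u) *m differential f (pt c u) =
    gradient (f \o pt c) u.
  move=> sf; rewrite differentialE -chart_gradient_change//.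
    by rewrite /chart_gradient crd_pt.
  exact: smooth_function_differentiable.
by rewrite covector_wedgeM !E.
Qed.

Lemma smooth_gradient c (f : M -> R) : atlas M c -> smooth_function f ->
  smooth_on (crd c @` dom c) (gradient (f \o pt c)).
Proof.
move=> ac sf k; have oi := @img_open _ _ _ c; apply/(Ck_mxP oi) => i j.
apply: (Ck_ext oi (f := fun u => 'D_(delta_mx 0 i) (f \o pt c) u)).
  by move=> u _; rewrite mxE.
exact: smooth_derive (sf c ac) _.
Qed.

Lemma twisted_2form : differential_2form omega -> differential_2form twisted_form.
Proof.
move=> [oT os]; split=> [p|c ac k].
  rewrite /twisted_form linearB/= oT opprB addrC; congr (_ - _).
  rewrite linear_sum/= -sumrN; apply: eq_bigr => i _.
  by rewrite /covector_wedge linearB/= !trmx_mul !trmxK opprB.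
have oi := @img_open _ _ _ c.
apply: (Ck_ext oi (f := fun u => form_in_chart omega c u + - dpart c u)).
  by move=> u iu; rewrite twisted_form_in_chart.
apply: Ck_add => //; first exact: os.
apply: Ck_opp => //; apply: Ck_sum => // i _.
apply: Ck_add => //; last apply: Ck_opp => //;
  by apply: Ck_mulmx => //; [|apply: Ck_trmx => //]; apply: smooth_gradient.
Qed.

(** This is d (dF /\ dK) = 0: the product rule leaves second derivatives of one function times first
    derivatives of the other, and these cancel in the alternating sum by [schwarz]. *)
Lemma twisted_closed : differential_2form omega ->
  (forall p i j k, exterior_derivative omega p i j k = 0) ->
  forall p i j k, exterior_derivative twisted_form p i j k = 0.
Proof.
move=> [_ os] ocl p i j k; pose c := chart_at p; pose u0 := crd c p.
have [ac cp] := (atlas_chart_at p : atlas M c, dom_chart_at p : dom c p).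
have iu0 : (crd c @` dom c) u0 by exists p.
have oi := @img_open _ _ _ c.
pose D (f : M -> R) (b : 'I_m) (u : 'rV[R]_m) : R := 'D_(delta_mx 0 b) (f \o pt c) u.
pose H (f : M -> R) (a b : 'I_m) : R := 'D_(delta_mx 0 a) (D f b) u0.
have HC f a b : smooth_function f -> H f a b = H f b a.
  by move=> sf; rewrite /H /D (schwarz _ _ oi (sf c ac) iu0).
have dD f a v : smooth_function f -> derivable (D f a) u0 v.
  move=> sf; exact: smooth_derivable (smooth_derive _ (sf c ac)) iu0.
(* The derivative along axis [a] of the (b, d) entry of dF_s /\ dK_s. *)
pose Q (s : 'I_r) (a b d : 'I_m) :=
  H (F s) a b * D (K s) d u0 + D (F s) b u0 * H (K s) a d
  - (H (K s) a b * D (F s) d u0 + D (K s) b u0 * H (F s) a d).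
have E a b d : 'D_(delta_mx 0 a) (fun u => form_in_chart twisted_form c u b d) u0 =
    'D_(delta_mx 0 a) (fun u => form_in_chart omega c u b d) u0
    - \sum_s Q s a b d.
  have dW : derivable (fun u => form_in_chart omega c u b d) u0 (delta_mx 0 a).
    by have /derivable_mxP := smooth_derivable (os c ac) iu0 (v := delta_mx 0 a).
  pose N (s : 'I_r) := D (F s) b * D (K s) d - D (K s) b * D (F s) d : 'rV[R]_m -> R.
  have dM f g a' b' : smooth_function f -> smooth_function g ->
      derivable (D f a' * D g b') u0 (delta_mx 0 a).
    by move=> sf sg; apply: derivableM; exact: dD.
  have dN s : derivable (N s) u0 (delta_mx 0 a) by apply: derivableB; exact: dM.
  rewrite (@near_eq_derive _ _ _ _ ((fun u => form_in_chart omega c u b d) - \sum_s N s)).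
    rewrite (deriveB dW (derivable_sum dN)).
    congr (_ - _); rewrite (derive_sum dN); apply: eq_bigr => s _.
    rewrite (deriveB (dM _ _ _ _ (sF s) (sK s)) (dM _ _ _ _ (sK s) (sF s))).
    by rewrite (derive_mulr (dD _ _ _ (sF s)) (dD _ _ _ (sK s)))
      (derive_mulr (dD _ _ _ (sK s)) (dD _ _ _ (sF s))).
  apply: filterS (near_img cp) => u iu.
  have subE (A B : 'M[R]_m) : (A - B) b d = A b d - B b d by rewrite !mxE.
  rewrite twisted_form_in_chart// subE.
  rewrite -[RHS]/(form_in_chart omega c u b d - (\sum_s N s) u); congr (_ - _).
  rewrite /dpart summxE fct_sumE; apply: eq_bigr => s _.
  by rewrite /covector_wedge subE !mxE !big_ord1 !mxE.
have := ocl p i j k; rewrite /exterior_derivative -/c -/u0 => Ho.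
have QE s a b d : Q s a b d =
  H (F s) a b * D (K s) d u0 + D (F s) b u0 * H (K s) a d
  - (H (K s) a b * D (F s) d u0 + D (K s) b u0 * H (F s) a d) by [].
rewrite (E i j k) (E j i k) (E k i j).
clear E dD; clearbody Q H D.
transitivity (- \sum_s (Q s i j k - Q s j i k + Q s k i j)).
  rewrite big_split/= sumrB; move: Ho.
  generalize (\sum_s Q s i j k) (\sum_s Q s j i k) (\sum_s Q s k i j).
  generalize ('D_(delta_mx 0 i) (fun u => form_in_chart omega c u j k) u0)
     ('D_(delta_mx 0 j) (fun u => form_in_chart omega c u i k) u0)
     ('D_(delta_mx 0 k) (fun u => form_in_chart omega c u i j) u0).
  move=> A B C a b d Ho; rewrite -[RHS]add0r -Ho; ring.
rewrite big1 ?oppr0// => s _; rewrite !QE.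
rewrite (HC (F s) j i)// (HC (F s) k i)// (HC (F s) k j)//.
rewrite (HC (K s) j i)// (HC (K s) k i)// (HC (K s) k j)//.
generalize (H (F s) i j) (H (F s) i k) (H (F s) j k) (H (K s) i j) (H (K s) i k)
  (H (K s) j k) (D (F s) i u0) (D (F s) j u0) (D (F s) k u0) (D (K s) i u0)
  (D (K s) j u0) (D (K s) k u0) => *; ring.
Qed.

End Twist.

Lemma lin1_mx_mul (R : realType) (m n : nat) (f : 'rV[R]_m -> 'rV[R]_n) (A : 'M[R]_(m, n)) :
  (forall v, f v = v *m A) -> lin1_mx f = A.
Proof. by move=> fE; apply/matrixP => i j; rewrite mxE fE -rowE mxE. Qed.

Lemma wedge_congruence (R : realType) (m n : nat) (X Y : 'rV[R]_n) (A : 'M[R]_(n, m)) :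
  A^T *m wedge X Y *m A = wedge (X *m A) (Y *m A).
Proof. by rewrite /wedge mulmxBr mulmxBl !trmx_mul !mulmxA. Qed.

(** Raising both indices with an antisymmetric [P] costs one sign; it is the reason why subtracting
    t_M adds pi E pi. *)
Lemma wedge_covector_wedge (R : realType) (m : nat) (P : 'M[R]_m) (a b : 'cV[R]_m) :
  P^T = - P -> wedge (a^T *m P) (b^T *m P) = - (P *m covector_wedge a b *m P).
Proof.
move=> PT; rewrite /wedge /covector_wedge.
by rewrite !trmx_mul !trmxK PT !mulNmx mulmxBr mulmxBl !mulmxA opprK opprB addrC.
Qed.

(** Each of the four terms of the expanded product contains one of the scalars assumed to vanish. *)
Lemma covector_wedge_isotropic (R : realType) (m : nat) (P : 'M[R]_m)
    (a b a' b' : 'cV[R]_m) :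
  a^T *m P *m a' = 0 -> a^T *m P *m b' = 0 ->
  b^T *m P *m a' = 0 -> b^T *m P *m b' = 0 ->
  covector_wedge a b *m P *m covector_wedge a' b' = 0.
Proof.
move=> aa ab ba bb; rewrite /covector_wedge mulmxBr !mulmxBl.
have Z (x y x' y' : 'cV[R]_m) : y^T *m P *m x' = 0 ->
    x *m y^T *m P *m (x' *m y'^T) = 0.
  by move=> H; rewrite -(mulmxA x) -(mulmxA x) (mulmxA _ x') H mul0mx mulmx0.
by rewrite (Z _ _ _ _ ba) (Z _ _ _ _ aa) (Z _ _ _ _ bb) (Z _ _ _ _ ab) !subrr.
Qed.

(** * Twists whose moments Poisson-commute *)

Section Deformation.
Context {R : realType} {m n : nat} {M : manifold R m}.
Variables (omega pi : M -> 'M[R]_m) (mu : M -> 'cV[R]_n).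
Hypotheses (symp : symplectic_form omega) (inv : forall p, omega p *m pi p = 1%:M).
Hypothesis smu : smooth_function mu.

Definition moment_component (X : 'rV[R]_n) (q : M) : R := pairing X (mu q).

Lemma moment_component_smooth X : smooth_function (moment_component X).
Proof.
move=> c ac k; have oi := @img_open _ _ _ c.
have /(Ck_mxP oi)/(_ 0 0) : Ck k (crd c @` dom c) (fun u => X *m mu (pt c u)).
  by apply: Ck_mulmx => //; [exact: Ck_cst|exact: smu].
exact: Ck_ext.
Qed.

(** [L] is the Jacobian of [mu] in the chart at [p]. Together with [fundamental_vectorE] it makes X
    |-> X_M linear. *)
Lemma differential_moment_linear p :
  exists L : 'M[R]_(n, m), forall X, (differential (moment_component X) p)^T = X *m L.
Proof.
pose c := chart_at p; pose u0 := crd c p.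
have [ac cp] := (atlas_chart_at p : atlas M c, dom_chart_at p : dom c p).
have iu0 : (crd c @` dom c) u0 by exists p.
have dmu v : derivable (mu \o pt c) u0 v by exact: smooth_derivable (smu ac) iu0.
exists (\matrix_(j, i) 'D_(delta_mx 0 i) (mu \o pt c) u0 j 0) => X.
apply/rowP => i; rewrite [LHS]mxE [LHS]mxE -/c -/u0.
have dX := is_derive_mulmx (derivable_cst X u0 (delta_mx 0 i)) (dmu (delta_mx 0 i)).
have [dXd dXE] := dX.
rewrite [LHS](derive_entry 0 0 dXd) dXE derive_cst mul0mx add0r !mxE.
by apply: eq_bigr => j _; rewrite mxE.
Qed.

(** {mu^X, mu^Y} = 0, kept as a 1 x 1 matrix so that it can be recognized inside matrix products. *)
Definition moments_commute (X Y : 'rV[R]_n) := forall p,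
  (differential (moment_component X) p)^T *m pi p *m
    differential (moment_component Y) p = 0.

Lemma moments_commuteZ a X Y : moments_commute X Y -> moments_commute (a *: X) Y.
Proof.
move=> cXY p; have [L LE] := differential_moment_linear p.
by rewrite LE -!scalemxAl -LE cXY scaler0.
Qed.

Lemma moments_commuteC X Y : moments_commute X Y -> moments_commute Y X.
Proof.
move=> cXY p; have [[piT _] _] := symplectic_inverse_poisson inv symp.
apply: trmx_inj; rewrite !trmx_mul trmxK piT mulNmx mulmxN mulmxA cXY.
by rewrite oppr0 trmx0.
Qed.

Variables (G : lie_group R n) (expG : 'rV[R]_n -> G) (sigma : G -> M -> M).
Hypothesis dmu : forall X p, differential (moment_component X) p =
  Defs.contraction (fundamental_vector expG sigma X p) (omega p).

Lemma fundamental_vectorE X p :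
  fundamental_vector expG sigma X p = (differential (moment_component X) p)^T *m pi p.
Proof. by rewrite dmu /Defs.contraction trmxK -mulmxA inv mulmx1. Qed.

(** [fundamental_bivector] uses [lin1_mx], which records only the values on basis vectors; linearity
    of X |-> X_M makes this matrix give the right value on every [X i] and [Y i]. *)
Lemma fundamental_bivector_sum r (X Y : 'I_r -> 'rV[R]_n) p :
  fundamental_bivector expG sigma (\sum_i wedge (X i) (Y i)) p =
  \sum_i wedge (fundamental_vector expG sigma (X i) p)
    (fundamental_vector expG sigma (Y i) p).
Proof.
have [L LE] := differential_moment_linear p.
have fE Z : fundamental_vector expG sigma Z p = Z *m (L *m pi p).
  by rewrite fundamental_vectorE LE mulmxA.
rewrite /fundamental_bivector (lin1_mx_mul fE) mulmx_sumr mulmx_suml.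
by apply: eq_bigr => i _; rewrite wedge_congruence !fE.
Qed.

Lemma commuting_twist_deforms r (X Y : 'I_r -> 'rV[R]_n) :
  (forall i j, moments_commute (X i) (X j)) ->
  (forall i j, moments_commute (X i) (Y j)) ->
  (forall i j, moments_commute (Y i) (Y j)) ->
  deforms expG sigma (\sum_i wedge (X i) (Y i)) pi.
Proof.
move=> cXX cXY cYY.
have cYX i j : moments_commute (Y i) (X j) by exact: moments_commuteC.
have [[piT _] _] := symplectic_inverse_poisson inv symp.
have [form2 ocl _] := symp.
pose F i := moment_component (X i); pose K i := moment_component (Y i).
pose ot := twisted_form omega F K.
pose pt_ p := pi p - fundamental_bivector expG sigma (\sum_i wedge (X i) (Y i)) p.
have invt p : ot p *m pt_ p = 1%:M.
  rewrite /ot /twisted_form /pt_ fundamental_bivector_sum.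
  set E := \sum_i covector_wedge _ _.
  have -> : \sum_i wedge (fundamental_vector expG sigma (X i) p)
    (fundamental_vector expG sigma (Y i) p) = - (pi p *m E *m pi p).
    rewrite /E mulmx_sumr mulmx_suml -sumrN; apply: eq_bigr => i _.
    by rewrite !fundamental_vectorE wedge_covector_wedge.
  have EpiE : E *m pi p *m E = 0.
    rewrite /E mulmx_suml mulmx_suml big1// => i _.
    rewrite mulmx_sumr big1// => j _.
    by apply: covector_wedge_isotropic; [exact: cXX|exact: cXY|exact: cYX|exact: cYY].
  rewrite opprK mulmxBl !mulmxDr inv !mulmxA EpiE mul0mx inv mul1mx addr0 addrK//.
have st : symplectic_form ot.
  split.
  - by apply: twisted_2form => // i; exact: moment_component_smooth.
  - by apply: twisted_closed => // i; exact: moment_component_smooth.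
  - move=> p v; rewrite /Defs.contraction => /(congr1 trmx); rewrite trmxK trmx0 => v0.
    by rewrite -[v]mulmx1 -(invt p) mulmxA v0 mul0mx.
split.
- exact: symplectic_inverse_poisson invt st.
- exact: inverse_nondegenerate invt.
(* Uniqueness: a form inducing [pt_] is the pointwise matrix inverse of [pt_]. *)
- exists ot; split; first by split => //; apply/inducesP.
  move=> o' [_ /inducesP invo']; apply/funext => p.
  by rewrite -[RHS]mul1mx -(invt p) -mulmxA (mulmx1C (invo' p)) mulmx1.
Qed.

End Deformation.

(** * Lie groups and their actions *)

Section Pairs.
Context {R : realType}.

Lemma is_derive_pair (U V W : normedModType R) (f : U -> V) (g : U -> W) x v df dg :
  is_derive x v f df -> is_derive x v g dg ->
  is_derive x v (fun y => (f y, g y)) (df, dg).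
Proof.
move=> [cf <-] [cg <-].
have H : (fun h : R => h^-1 *: (((fun y => (f y, g y)) \o shift x) (h *: v) - (f x, g x)))
    @ 0^' --> ('D_v f x, 'D_v g x).
  apply: (cvg_pair (F := 0^') (f := fun h : R => h^-1 *: ((f \o shift x) (h *: v) - f x))
    (g := fun h : R => h^-1 *: ((g \o shift x) (h *: v) - g x))).
    exact: cf.
  exact: cg.
apply: DeriveDef; first by apply/cvg_ex; exists ('D_v f x, 'D_v g x).
exact/cvg_lim.
Qed.

Lemma is_derive_const (U V : normedModType R) (x v : U) (a : V) :
  is_derive x v (fun=> a) 0.
Proof. exact: is_derive_cst. Qed.

Lemma shift_snd (V V' : normedModType R) (u : V) (v Y : V') (h : R) :
  h *: ((0, Y) : V * V') + (u, v) = (u, h *: Y + v).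
Proof. by rewrite -[LHS]/(h *: 0 + u, h *: Y + v) scaler0 add0r. Qed.

Lemma shift_fst (V V' : normedModType R) (u X : V) (v : V') (h : R) :
  h *: ((X, 0) : V * V') + (u, v) = (h *: X + u, v).
Proof. by rewrite -[LHS]/(h *: X + u, h *: 0 + v) scaler0 add0r. Qed.

Lemma derive_snd (V V' W : normedModType R) (f : V * V' -> W) u v Y :
  'D_Y (fun y => f (u, y)) v = 'D_((0, Y) : V * V') f (u, v).
Proof.
rewrite /derive; set A := (X in lim (X @ _)); set B := (X in _ = lim (X @ _)).
suff -> : A = B by [].
by apply/funext => h; rewrite /A /B /= shift_snd.
Qed.

Lemma derivable_snd (V V' W : normedModType R) (f : V * V' -> W) u v Y :
  derivable f (u, v) ((0, Y) : V * V') -> derivable (fun y => f (u, y)) v Y.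
Proof.
rewrite /derivable; set A := (X in cvg (X @ _)); set B := (X in _ -> cvg (X @ _)).
suff -> : A = B by [].
by apply/funext => h; rewrite /A /B /= shift_snd.
Qed.

Lemma derive_fst (V V' W : normedModType R) (f : V * V' -> W) u v X :
  'D_X (fun y => f (y, v)) u = 'D_((X, 0) : V * V') f (u, v).
Proof.
rewrite /derive; set A := (X in lim (X @ _)); set B := (X in _ = lim (X @ _)).
suff -> : A = B by [].
by apply/funext => h; rewrite /A /B /= shift_fst.
Qed.

Lemma differentiable_fst (V V' W : normedModType R) (f : V * V' -> W) u v :
  differentiable f (u, v) -> differentiable (fun y => f (y, v)) u.
Proof.
by move=> df; apply: (@differentiable_comp _ _ _ _ (fun y : V => (y, v)) f).
Qed.

Lemma derive_through_chart m (N : manifold R m) (V : normedModType R)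
    (F : V -> N) (x v : V) (c : chart R m N) (f : N -> R) :
  dom c (F x) -> (\forall y \near x, dom c (F y)) ->
  derivable (crd c \o F) x v -> differentiable (f \o pt c) (crd c (F x)) ->
  is_derive x v (f \o F) (pairing ('D_v (crd c \o F) x) (chart_gradient f c (F x))).
Proof.
move=> dx ndx dF df; rewrite /chart_gradient -derive_gradient//.
apply: near_eq_is_derive (derive_comp (f := f \o pt c) df dF).
by apply: filterS ndx => y dy /=; rewrite crdK.
Qed.

Section Map2.
Variables (m n k : nat) (M : manifold R m) (N : manifold R n) (P : manifold R k).
Variables (F : M -> N -> P).
Hypothesis sF : smooth_map2 F.
Variables (c : chart R m M) (d : chart R n N) (e : chart R k P).
Hypotheses (ac : atlas M c) (ad : atlas N d) (ae : atlas P e).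

Definition map2_in_chart (w : 'rV[R]_m * 'rV[R]_n) := crd e (F (pt c w.1) (pt d w.2)).

Definition map2_dom : set ('rV[R]_m * 'rV[R]_n) :=
  [set u | [/\ (crd c @` dom c) u.1, (crd d @` dom d) u.2 &
            dom e (F (pt c u.1) (pt d u.2))]].

Lemma map2_domP p q : dom c p -> dom d q -> dom e (F p q) ->
  map2_dom (crd c p, crd d q).
Proof. by move=> cp dq eF; split=> /=; [exists p|exists q|rewrite !crdK]. Qed.

Lemma near_map2 p q (A : P -> Prop) : (\forall x \near F p q, A x) ->
  \forall x \near (p, q), A (F x.1 x.2).
Proof. by move=> nA; have [+ _] := sF; move=> /(_ (p, q)); apply. Qed.

Lemma open_map2_dom : open map2_dom.
Proof.
rewrite openE => -[u v] [/= iu iv eF]; rewrite /interior.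
have nF := near_map2 (near_dom eF).
have cc : (fun w : 'rV[R]_m * 'rV[R]_n => (pt c w.1, pt d w.2)) @ (u, v)
    --> (pt c u, pt d v).
  apply: cvg_pair.
    by apply: (@cvg_comp _ _ _ fst (pt c) _ (nbhs u)); [exact: cvg_fst|exact: pt_continuous].
  by apply: (@cvg_comp _ _ _ snd (pt d) _ (nbhs v)); [exact: cvg_snd|exact: pt_continuous].
have n1 : \forall w \near (u, v), (crd c @` dom c) w.1.
  apply: (@cvg_fst _ _ (nbhs u) (nbhs v)); apply: open_nbhs_nbhs; split => //; exact: img_open.
have n2 : \forall w \near (u, v), (crd d @` dom d) w.2.
  apply: (@cvg_snd _ _ (nbhs u) (nbhs v)); apply: open_nbhs_nbhs; split => //; exact: img_open.
have n3 := cc _ nF.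
by near=> w; split; near: w.
Unshelve. all: by end_near. Qed.

Lemma smooth_map2_in_chart j : smooth_on map2_dom (fun w => map2_in_chart w 0 j).
Proof.
move=> l; have [_ /(_ c d e ac ad ae l)] := sF.
by move=> /(Ck_mxP open_map2_dom); apply.
Qed.

Lemma map2_derivable w v : map2_dom w -> derivable map2_in_chart w v.
Proof. by have [_ /(_ c d e ac ad ae) s] := sF; exact: smooth_derivable. Qed.

Lemma map2_dom_differentiable (f : 'rV[R]_m * 'rV[R]_n -> R) w :
  smooth_on map2_dom f -> map2_dom w -> differentiable f w.
Proof.
move=> sf; apply: smooth_differentiable sf; last exact: open_map2_dom.
by apply: finite_dim_prod; exact: finite_dim_rV.
Qed.

End Map2.
End Pairs.

(** * The bracket and the adjoint action in the chart at the identity *)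

Section LieGroup.
Context {R : realType} {n : nat} (G : lie_group R n).

Let c := chart_at (lg_one G).
Let e0 : 'rV[R]_n := crd c (lg_one G).
Let mm := map2_in_chart (@lg_mul R n G) c c c.
Let S := map2_dom (@lg_mul R n G) c c c.
Let ac : atlas G c. Proof. exact: atlas_chart_at. Qed.
Let c1 : dom c (lg_one G). Proof. exact: dom_chart_at. Qed.
Let sm : smooth_map2 (@lg_mul R n G). Proof. exact: lg_mul_smooth. Qed.
Let mmj j := fun w => mm w 0 j.

Let mm_smooth j : smooth_on S (mmj j).
Proof. exact: smooth_map2_in_chart. Qed.

Let Se0 g : dom c g -> S (crd c g, e0).
Proof. by move=> cg; apply: map2_domP => //; rewrite lg_mulg1. Qed.

Let Sinv g : dom c g -> dom c (lg_inv g) -> S (crd c g, crd c (lg_inv g)).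
Proof. by move=> cg cg'; apply: map2_domP => //; rewrite lg_mulgV. Qed.

(* The mixed second derivative of the multiplication at (1, 1), in the chart
   at 1. *)
Definition mul_hessian (X Y : 'rV[R]_n) (j : 'I_n) : R :=
  'D_((X, 0) : 'rV[R]_n * 'rV[R]_n)
    (fun w => 'D_((0, Y) : 'rV[R]_n * 'rV[R]_n)
       (fun w => map2_in_chart (@lg_mul R n G) (chart_at (lg_one G))
           (chart_at (lg_one G)) (chart_at (lg_one G)) w 0 j) w)
    (crd (chart_at (lg_one G)) (lg_one G), crd (chart_at (lg_one G)) (lg_one G)).

Let near_mul g (A : G -> Prop) h : dom c h -> (\forall x \near lg_mul g h, A x) ->
  \forall v \near crd c h, A (lg_mul g (pt c v)).
Proof.
move=> ch nA; have nM := near_map2 sm nA.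
have n2 : \forall x \near h, A (lg_mul g x).
  have cc : (fun x : G => (g, x)) @ h --> (g, h) by apply: cvg_pair; [exact: cvg_cst|].
  exact: cc _ nM.
exact: (near_pt (A := fun x => A (lg_mul g x))).
Qed.

(** The vector at [g] is recorded in [chart_at g]; pairing it with a coordinate differential gives
    its coordinate in the fixed chart [c], where it can be differentiated in [g]. *)
Let left_invariant_crd Y g i : dom c g ->
  pairing (left_invariant Y g) (differential (fun q => crd c q 0 i) g) =
  'D_((0, Y) : 'rV[R]_n * 'rV[R]_n) (mmj i) (crd c g, e0).
Proof.
move=> cg; rewrite /left_invariant /tangent_map -/c -/e0 lg_mulg1.
set d := chart_at g.
have [ad dg] := (atlas_chart_at g : atlas G d, dom_chart_at g : dom d g).
rewrite differentialE -/d.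
pose F v := lg_mul g (pt c v).
have Fe : F e0 = g by rewrite /F crdK// lg_mulg1.
have nd : \forall v \near e0, dom d (F v).
  by apply: near_mul => //; rewrite lg_mulg1; exact: near_dom.
have dF : derivable (crd d \o F) e0 Y.
  have : derivable (fun v => map2_in_chart (@lg_mul R n G) c c d (crd c g, v)) e0 Y.
    apply: derivable_snd; apply: map2_derivable => //.
    by apply: map2_domP => //; rewrite lg_mulg1.
  by rewrite /map2_in_chart /= crdK.
have := @derive_through_chart R n G _ F e0 Y d (fun q => crd c q 0 i).
rewrite Fe => /(_ dg nd dF (transition_differentiable i ad ac dg cg)) [_ <-].
rewrite -(derive_snd (mmj i)).
have -> : (fun v => mmj i (crd c g, v)) = (fun q => crd c q 0 i) \o F; last by [].
by apply/funext => v; rewrite /mmj /mm /map2_in_chart /= crdK.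
Qed.

(** The left-invariant field of Y applied to x_j is a derivative of the multiplication in its second
    slot, taken at (u, 1); deriving it along X then moves only the first slot. *)
Lemma lie_bracketE X Y j :
  lie_bracket G X Y 0 j = mul_hessian X Y j - mul_hessian Y X j.
Proof.
rewrite /lie_bracket /vfield_bracket mxE -/c.
suff H : forall Z T : 'rV[R]_n, pairing (left_invariant Z (lg_one G)) (differential (fun q : G =>
    pairing (left_invariant T q) (differential (fun q => crd c q 0 j) q)) (lg_one G)) =
    mul_hessian Z T j by rewrite !H.
move=> {}X {}Y.
have -> : left_invariant X (lg_one G) = X.
  rewrite /left_invariant /tangent_map -/c -/e0 lg_mulg1 -/c.
  rewrite (@near_eq_derive _ _ _ _ id) ?derive_id//.
  by apply: filterS (near_img c1) => v iv /=; rewrite lg_mul1g crd_pt.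
rewrite differentialE -/c.
pose h u := 'D_((0, Y) : 'rV[R]_n * 'rV[R]_n) (mmj j) (u, e0).
have dh : differentiable h e0.
  apply: (@differentiable_fst _ _ _ _
    (fun w => 'D_((0, Y) : 'rV[R]_n * 'rV[R]_n) (mmj j) w)).
  apply: (map2_dom_differentiable sm); last exact: Se0.
  exact: smooth_derive.
rewrite /mul_hessian -derive_fst -/(h _) derive_gradient//; congr pairing.
apply/colP => i; rewrite !mxE; apply: near_eq_derive.
apply: filterS (near_img c1) => u iu.
by rewrite [LHS]left_invariant_crd ?crd_pt//; exact: pt_img.
Qed.

(* Chain rule for mm (mm (g, v), g^-1), where mm is the multiplication read in
   the chart at 1. *)
Lemma Ad_in_chart g Y j : dom c g -> dom c (lg_inv g) ->
  Ad g Y 0 j = \sum_k 'D_((0, Y) : 'rV[R]_n * 'rV[R]_n) (mmj k) (crd c g, e0) *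
    'D_((delta_mx 0 k, 0) : 'rV[R]_n * 'rV[R]_n) (mmj j) (crd c g, crd c (lg_inv g)).
Proof.
move=> cg cg'; rewrite /Ad /tangent_map -/c -/e0 lg_mulg1 lg_mulgV -/c.
pose k (v : 'rV[R]_n) := mm (crd c g, v).
pose h i (u : 'rV[R]_n) := mmj i (u, crd c (lg_inv g)).
have ke : k e0 = crd c g by rewrite /k /mm /map2_in_chart/= !crdK// lg_mulg1.
have dk : derivable k e0 Y.
  by apply: derivable_snd; apply: map2_derivable => //; exact: Se0.
have dh i : differentiable (h i) (k e0).
  rewrite ke; apply: differentiable_fst.
  exact: (map2_dom_differentiable sm (mm_smooth i) (Sinv cg cg')).
have E : \forall v \near e0, (crd c \o (fun p => lg_mul (lg_mul g p) (lg_inv g)) \o pt c) v =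
    \row_i (h i \o k) v.
  have ngc : \forall v \near e0, dom c (lg_mul g (pt c v)).
    by apply: near_mul => //; rewrite lg_mulg1; exact: near_dom.
  apply: filterS ngc => v cgv; apply/rowP => i; rewrite mxE.
  by rewrite /= /h /mmj /k /mm /map2_in_chart /= !crdK.
rewrite (near_eq_derive _ E).
have dhk i : is_derive e0 Y (h i \o k) ('D_('D_Y k e0) (h i) (k e0)) by exact: derive_comp.
rewrite -derive_entry; last first.
  apply/derivable_mxP => a b; have [dd _] := dhk b.
  by have -> : (fun x => (\row_i (h i \o k) x) a b) = h b \o k by apply/funext => x; rewrite mxE.
have -> : (fun x => (\row_i (h i \o k) x) 0 j) = h j \o k by apply/funext => x; rewrite mxE.
have [_ ->] := dhk j.
rewrite derive_gradient// /pairing mxE; apply: eq_bigr => i _; congr (_ * _).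
  by rewrite -derive_entry// -derive_snd.
by rewrite mxE -derive_fst ke.
Qed.

(** [coAd] is defined by the matrix of [Ad] on basis vectors, so linearity is needed to evaluate it
    on an arbitrary [Y]. Elements [g] near 1 satisfy both hypotheses. *)
Lemma Ad_linear g Y : dom c g -> dom c (lg_inv g) -> Y *m lin1_mx (Ad g) = Ad g Y.
Proof.
move=> cg cg'; apply/rowP => j; rewrite mxE.
under eq_bigr do rewrite mxE Ad_in_chart// mulr_sumr.
rewrite exchange_big Ad_in_chart//=; apply: eq_bigr => k _.
under eq_bigr do rewrite mulrA; rewrite -mulr_suml; congr (_ * _).
rewrite {2}(row_sum_delta Y).
have -> : ((0, \sum_i Y 0 i *: delta_mx 0 i) : 'rV[R]_n * 'rV[R]_n) =
    \sum_i Y 0 i *: ((0, delta_mx 0 i) : 'rV[R]_n * 'rV[R]_n).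
  elim/big_rec2: _ => // i y1 y2 _ <-.
  by rewrite -[RHS]/(_ *: 0 + 0, _ *: _ + y2) scaler0 addr0.
rewrite derive_sumZ//.
exact: (map2_dom_differentiable sm (mm_smooth k) (Se0 cg)).
Qed.

Lemma mul_hessian_linear Y X j :
  mul_hessian Y X j = \sum_k Y 0 k * mul_hessian (delta_mx 0 k) X j.
Proof.
rewrite {1}/mul_hessian {1}(row_sum_delta Y).
have -> : ((\sum_i Y 0 i *: delta_mx 0 i, 0) : 'rV[R]_n * 'rV[R]_n) =
    \sum_i Y 0 i *: ((delta_mx 0 i, 0) : 'rV[R]_n * 'rV[R]_n).
  elim/big_rec2: _ => // i y1 y2 _ <-.
  by rewrite -[RHS]/(_ *: _ + y2, _ *: 0 + 0) scaler0 addr0.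
rewrite derive_sumZ//.
exact: (map2_dom_differentiable sm (smooth_derive _ (mm_smooth j)) (Se0 c1)).
Qed.

Let mm_e0 u : (crd c @` dom c) u -> mm (u, e0) = u.
Proof. by move=> iu; rewrite /mm /map2_in_chart /= crdK// lg_mulg1 crd_pt. Qed.

Let e0_mm v : (crd c @` dom c) v -> mm (e0, v) = v.
Proof. by move=> iv; rewrite /mm /map2_in_chart /= crdK// lg_mul1g crd_pt. Qed.

Let derive_crd (u Z : 'rV[R]_n) k : 'D_Z (fun v : 'rV[R]_n => v 0 k) u = Z 0 k.
Proof. by rewrite (derive_entry (f := id) 0 k (@derivable_id _ _ u Z)) derive_id. Qed.

Let derive_mm_snd Y k : 'D_((0, Y) : 'rV[R]_n * 'rV[R]_n) (mmj k) (e0, e0) = Y 0 k.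
Proof.
rewrite -(derive_snd (mmj k)) -(derive_crd e0 Y k); apply: near_eq_derive.
by apply: filterS (near_img c1) => v iv; rewrite /mmj e0_mm.
Qed.

Let derive_mm_fst u X k : (crd c @` dom c) u ->
  'D_((X, 0) : 'rV[R]_n * 'rV[R]_n) (mmj k) (u, e0) = X 0 k.
Proof.
move=> iu; rewrite -(derive_fst (mmj k)) -(derive_crd u X k); apply: near_eq_derive.
have : \forall v \near u, (crd c @` dom c) v.
  by apply: open_nbhs_nbhs; split => //; exact: img_open.
by apply: filterS => v iv; rewrite /mmj mm_e0.
Qed.

(** Product rule on [Ad_in_chart]. At s = 0 the factors are Y_k and the Kronecker symbol of (j, k).
    Varying the first gives [mul_hessian X Y]; varying the second, whose arguments move along (X,
    -X), gives [- mul_hessian Y X]. The derivative of the inverse curve is a hypothesis because for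
    exp (sX) that curve is again a one-parameter subgroup. *)
Lemma derive_Ad_curve (a : R -> G) X Y j : a 0 = lg_one G ->
  (\forall s \near (0 : R), dom (chart_at (lg_one G)) (a s)) ->
  (\forall s \near (0 : R), dom (chart_at (lg_one G)) (lg_inv (a s))) ->
  is_derive (0 : R) 1 (crd (chart_at (lg_one G)) \o a) X ->
  is_derive (0 : R) 1 (fun s => crd (chart_at (lg_one G)) (lg_inv (a s))) (- X) ->
  is_derive (0 : R) 1 (fun s => Ad (a s) Y 0 j) (lie_bracket G X Y 0 j).
Proof.
move=> a0 nc nc' da db; rewrite -/c in nc nc' da db.
have ia0 : lg_inv (a 0) = lg_one G by rewrite a0 -[LHS]lg_mulg1 lg_mulVg.
pose al s := crd c (a s); pose be s := crd c (lg_inv (a s)).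
pose P k w := 'D_((0, Y) : 'rV[R]_n * 'rV[R]_n) (mmj k) w.
pose Q k w := 'D_((delta_mx 0 k, 0) : 'rV[R]_n * 'rV[R]_n) (mmj j) w.
have al0 : al 0 = e0 by rewrite /al a0.
have be0 : be 0 = e0 by rewrite /be ia0.
have dP k : differentiable (P k) (e0, e0).
  exact: (map2_dom_differentiable sm (smooth_derive _ (mm_smooth k)) (Se0 c1)).
have dQ k : differentiable (Q k) (e0, e0).
  exact: (map2_dom_differentiable sm (smooth_derive _ (mm_smooth j)) (Se0 c1)).
have DP k : is_derive (0 : R) 1 (fun s => P k (al s, e0)) (mul_hessian X Y k).
  have [dd EE'] := is_derive_pair da (is_derive_const (0 : R) 1 e0).
  have := @derive_comp _ _ _ _ (P k) (fun s => (al s, e0)) 0 1.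
  by rewrite al0 EE'; apply.
have DQ k : is_derive (0 : R) 1 (fun s => Q k (al s, be s)) (- mul_hessian (delta_mx 0 k) X j).
  have [dd EE'] := is_derive_pair da db.
  have := @derive_comp _ _ _ _ (Q k) (fun s => (al s, be s)) 0 1.
  rewrite al0 be0 EE' => /(_ (dQ k) dd).
  have -> : ((X, - X) : 'rV[R]_n * 'rV[R]_n) = (-1) *: ((0, X) : 'rV[R]_n * 'rV[R]_n) + (X, 0).
    by rewrite -[RHS]/(-1 *: 0 + X, -1 *: X + 0) scaler0 add0r addr0 scaleN1r.
  rewrite (derive_linear (dQ k)) scaleN1r.
  (* mm (u, e0) = u is linear in u, so the pure second derivative vanishes. *)
  have -> : 'D_((X, 0) : 'rV[R]_n * 'rV[R]_n) (Q k) (e0, e0) = 0.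
    rewrite -(derive_fst (Q k)).
    rewrite (@near_eq_derive _ _ _ _ (fun=> (delta_mx 0 k : 'rV[R]_n) 0 j)) ?derive_cst//.
    by apply: filterS (near_img c1) => u iu; exact: derive_mm_fst.
  (* [mul_hessian] derives in the second slot first; [schwarz] restores that order. *)
  rewrite addr0 /Q (schwarz _ _ (@open_map2_dom _ _ _ _ _ _ _ _ sm c c c) (mm_smooth j) (Se0 c1)).
  exact.
pose Z k : R -> R := (fun s => P k (al s, e0)) * (fun s => Q k (al s, be s)).
have DZ k : is_derive (0 : R) 1 (Z k)
    (Y 0 k * - mul_hessian (delta_mx 0 k) X j + (j == k)%:R * mul_hessian X Y k).
  have := is_deriveM (DP k) (DQ k).
  rewrite al0 be0 /P /Q derive_mm_snd derive_mm_fst; last by exists (lg_one G).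
  by rewrite mxE eqxx.
have Esum : lie_bracket G X Y 0 j = \sum_k
   (Y 0 k * - mul_hessian (delta_mx 0 k) X j + (j == k)%:R * mul_hessian X Y k).
  rewrite lie_bracketE (mul_hessian_linear Y X) big_split/= addrC -sumrN; congr (_ + _); last first.
    by apply: eq_bigr => k _; rewrite mulrN.
  rewrite (bigD1 j)//= eqxx mul1r big1 ?addr0// => k /negbTE kj.
  by rewrite eq_sym kj mul0r.
rewrite Esum; apply: near_eq_is_derive (is_derive_sum DZ).
near=> s; rewrite fct_sumE Ad_in_chart//; first by near: s.
by near: s.
Unshelve. all: by end_near. Qed.

End LieGroup.

(** * One-parameter subgroups, their orbits and the moment map *)

Section Exponential.
Context {R : realType} {n : nat} (G : lie_group R n) (expG : 'rV[R]_n -> G).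
Hypothesis hexp : exponential_map expG.

(** Additivity makes [expG 0] idempotent, and the only idempotent of a group is 1. *)
Lemma lie_exp0 : expG 0 = lg_one G.
Proof.
have [_ /(_ 0 0) H _] := hexp 0; move: H; rewrite !scaler0 => H.
by rewrite -(lg_mulVg (expG 0)) {3}H lg_mulA lg_mulVg lg_mul1g.
Qed.

Lemma lie_exp_inv s X : lg_inv (expG (s *: X)) = expG (s *: - X).
Proof.
have [_ H _] := hexp X; have := H (- s) s; rewrite addNr scale0r lie_exp0 => E.
by rewrite -[LHS]lg_mul1g E -lg_mulA lg_mulgV lg_mulg1 scaleNr scalerN.
Qed.

Lemma lie_exp_continuous X : continuous (fun s : R => expG (s *: X)).
Proof. by have [[]] := hexp X. Qed.

Lemma near_lie_exp X (A : G -> Prop) : (\forall g \near lg_one G, A g) ->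
  \forall s \near (0 : R), A (expG (s *: X)).
Proof.
move=> nA; have := @lie_exp_continuous X 0; rewrite /continuous_at scale0r lie_exp0.
exact.
Qed.

Lemma derive_lie_exp X :
  is_derive (0 : R) 1 (fun s => crd (chart_at (lg_one G)) (expG (s *: X))) X.
Proof.
have [[_ /(_ _ (atlas_chart_at (lg_one G))) s] _ v] := hexp X.
apply: DeriveDef.
  apply: smooth_derivable s _.
  by rewrite /preimage/= scale0r lie_exp0; exact: dom_chart_at.
by move: v; rewrite /velocity scale0r lie_exp0 derive1E.
Qed.

Section Action.
Context {m : nat} {M : manifold R m}.
Variables (omega pi : M -> 'M[R]_m) (mu : M -> 'cV[R]_n) (sigma : G -> M -> M).
Hypotheses (inv : forall p, omega p *m pi p = 1%:M).
Hypotheses (act : smooth_action sigma) (mom : moment_map expG sigma omega mu).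

(** The chain rule needs the limit defining the velocity to exist: [sigma] is jointly smooth and
    [expG] is smooth along the line of [X]. *)
Lemma orbit_derivable X p :
  derivable (crd (chart_at p) \o (fun s : R => sigma (expG (s *: X)) p)) 0 1.
Proof.
have [sm s1 _] := act.
set c := chart_at (lg_one G); set d := chart_at p.
have [ac ad] := (atlas_chart_at _ : atlas G c, atlas_chart_at _ : atlas M d).
have [c1 dp] := (dom_chart_at _ : dom c (lg_one G), dom_chart_at _ : dom d p).
pose Phi := map2_in_chart sigma c d d.
apply/derivable_mxP => i j; rewrite (ord1 i).
have Sp : map2_dom sigma c d d (crd c (lg_one G), crd d p).
  by apply: map2_domP => //; rewrite s1.
have dP := map2_dom_differentiable sm (smooth_map2_in_chart sm ac ad ad j) Sp.
have [dd _] := is_derive_pair (derive_lie_exp X) (is_derive_const (0 : R) 1 (crd d p)).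
have E0 : (crd c (expG (0 *: X)), crd d p) = (crd c (lg_one G), crd d p).
  by rewrite scale0r lie_exp0.
rewrite -E0 in dP.
have [dPhi _] := derive_comp dP dd.
apply: near_eq_derivable dPhi.
have nc := near_lie_exp X (near_dom c1).
by apply: filterS nc => s cs; rewrite /= /map2_in_chart /= !crdK.
Qed.

(** The derivative at s = 0 of mu^Y (exp (-sX) p) is computed twice: as the pairing of (-X)_M with d
    mu^Y, which is {mu^(-X), mu^Y}, and by equivariance as <mu(p), [X, Y]>. *)
Lemma bracket0_moments_commute X Y :
  lie_bracket G X Y = 0 -> moments_commute pi mu X Y.
Proof.
have [sm s1 sA] := act; have [smu dmu equiv] := mom.
(* The coadjoint action involves g^-1, so the orbit is followed along -X in order that
   [Ad (expG (s *: X))] appears; rescaling by -1 returns to X. *)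
move=> XY0; rewrite -[X]opprK -scaleN1r; apply: moments_commuteZ => // p.
pose F (s : R) := sigma (expG (s *: - X)) p.
have F0 : F 0 = p by rewrite /F scale0r lie_exp0 s1.
set d := chart_at p; have [ad dp] := (atlas_chart_at p : atlas M d, dom_chart_at p : dom d p).
have nF : \forall s \near (0 : R), dom d (F s).
  have n1 : \forall x \near (lg_one G, p), dom d (sigma x.1 x.2).
    by apply: (near_map2 sm); rewrite s1; exact: near_dom.
  have cc : (fun g : G => (g, p)) @ lg_one G --> (lg_one G, p).
    by apply: cvg_pair; [|exact: cvg_cst].
  exact: near_lie_exp (cc _ n1).
have := @derive_through_chart R m M _ F (0 : R) 1 d (moment_component mu Y).
rewrite F0 => /(_ dp nF (@orbit_derivable (- X) p)).
move=> /(_ (smooth_function_differentiable ad dp (moment_component_smooth smu Y))) [_ D].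
have fE : fundamental_vector expG sigma (- X) p = 'D_1 (crd d \o F) (0 : R).
  by rewrite /fundamental_vector /velocity scale0r lie_exp0 s1 derive1E.
rewrite -(fundamental_vectorE inv dmu) fE differentialE.
apply/matrixP => i j; rewrite !ord1 [RHS]mxE.
rewrite -[LHS]/(pairing _ _) -D.
have [nc nc'] := (near_lie_exp X (near_dom (dom_chart_at (lg_one G))),
  near_lie_exp (- X) (near_dom (dom_chart_at (lg_one G)))).
(* By equivariance mu^Y along the curve is the sum of the [W k], with [mu p] frozen and only [Ad]
   depending on s. *)
pose W (k : 'I_n) : R -> R := (fun s => Ad (expG (s *: X)) Y 0 k) * cst (mu p k 0).
have DW k : is_derive (0 : R) 1 (W k) 0.
  have dA : is_derive (0 : R) 1 (fun s => Ad (expG (s *: X)) Y 0 k) 0.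
    suff : is_derive (0 : R) 1 (fun s => Ad (expG (s *: X)) Y 0 k)
        (lie_bracket G X Y 0 k) by rewrite XY0 mxE.
    apply: derive_Ad_curve.
    - by rewrite scale0r lie_exp0.
    - exact: nc.
    - by apply: filterS nc' => s; rewrite lie_exp_inv.
    - exact: derive_lie_exp.
    - have -> : (fun s => crd (chart_at (lg_one G)) (lg_inv (expG (s *: X)))) =
          (fun s => crd (chart_at (lg_one G)) (expG (s *: - X))).
        by apply/funext => s; rewrite lie_exp_inv.
      exact: derive_lie_exp.
  have := is_deriveM dA (is_derive_const (0 : R) 1 (mu p k 0)).
  by rewrite !scaler0 addr0.
rewrite (@near_eq_derive _ _ _ _ (\sum_k W k)).
  by have [_ ->] := is_derive_sum DW; rewrite big1.
near=> s; rewrite /= /moment_component /F equiv /coAd lie_exp_inv opprK /pairing mulmxA.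
rewrite Ad_linear ?lie_exp_inv//; [|by near: s|by near: s].
by rewrite mxE fct_sumE.
Unshelve. all: by end_near. Qed.

End Action.
End Exponential.

Theorem theorem3p2 (R : realType) (m n : nat)
  (M : manifold R m) (omega : M -> 'M[R]_m)
  (G : lie_group R n) (expG : 'rV[R]_n -> G) (sigma : G -> M -> M)
  (pi : M -> 'M[R]_m) :
  symplectic_form omega ->
  connected [set: G] ->
  exponential_map expG ->
  symplectic_hamiltonian_action expG sigma omega ->
  induces omega pi ->
  (forall X Y : 'rV[R]_n, lie_bracket G X Y = 0 ->
     deforms expG sigma (2^-1 *: wedge X Y) pi) /\
  (forall h : {vspace 'rV[R]_n}, cartan_subalgebra G h ->
     (forall X Y : 'rV[R]_n, X \in h -> Y \in h -> lie_bracket G X Y = 0) /\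
     (forall t : 'M[R]_n, Lambda2 h t -> deforms expG sigma t pi)).
Proof.
move=> symp _ hexp [act _ [mu mom]] /inducesP inv.
have [smu dmu _] := mom.
have comm X Y := bracket0_moments_commute hexp inv act mom (X := X) (Y := Y).
have deform := commuting_twist_deforms symp inv smu dmu.
split=> [X Y XY0|h [hab _ _]].
  have XX0 Z : lie_bracket G Z Z = 0.
    by apply/rowP => j; rewrite lie_bracketE subrr mxE.
  (* The factor 1/2 is absorbed into X, giving a twist with a single summand. *)
  have -> : 2^-1 *: wedge X Y = \sum_(i < 1) wedge (2^-1 *: X) Y.
    by rewrite big_ord1 /wedge scalerBr [(2^-1 *: X)^T]linearZ/= -scalemxAl -scalemxAr.
  apply: (deform 1 (fun=> 2^-1 *: X) (fun=> Y)) => _ _.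
  - apply: (moments_commuteZ smu); apply: (moments_commuteC symp inv).
    by apply: (moments_commuteZ smu); apply: comm; exact: XX0.
  - by apply: (moments_commuteZ smu); exact: comm XY0.
  - by apply: comm; exact: XX0.
split=> [//|t [r [X [Y [XYh ->]]]]].
by apply: deform => i j; apply: comm; apply: hab; have [Xi Yi] := XYh i; have [] := XYh j.
Qed.
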